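(* Let $n\ge4$ be fixed and let $p\wedge q\to\infty$. Suppose that there are constants $a,b,a',b'$ not depending on $p,q$ with $0<a\le\inf_i \mathrm{var}(x_i)\le\sup_iE(x_i^2)\le b<\infty$ and $0<a'\le\inf_j \mathrm{var}(y_j)\le\sup_jE(y_j^2)\le b'<\infty$. (i) When $k(x,y)=l(x,y)=|x-y|^2$, $$dCov_n^2(\mathbf X,\mathbf Y)=\frac14\frac{\sqrt{pq}}{\tau}\,uCov_n^2(\mathbf X,\mathbf Y)+\mathcal R_n',$$ $$\tau\times hCov_n^2(\mathbf X,\mathbf Y)=\frac{\sqrt{pq}}{4\gamma_{\mathbf X}\gamma_{\mathbf Y}}f^{(1)}\!\left(\frac{\tau_X}{\gamma_{\mathbf X}}\right)g^{(1)}\!\left(\frac{\tau_Y}{\gamma_{\mathbf Y}}\right)uCov_n^2(\mathbf X,\mathbf Y)+\mathcal R_n'',$$ where $\mathcal R_n',\mathcal R_n''$ are the remainder terms. Further suppose that $L_X(X,X')=O_p(a_p)$ and $L_Y(Y,Y')=O_p(b_q)$, where $a_p,b_q$ are sequences of numbers with $a_p=o(1)$, $b_q=o(1)$, $\tau_X^2a_p^3=o(1)$, $\tau_Y^2b_q^3=o(1)$, $\tau a_p^2b_q=o(1)$, $\tau a_pb_q^2=o(1)$. Then $$uCov_n^2(\mathbf X,\mathbf Y)=O_p(\tau a_pb_q),\quad \mathcal R_n'=O_p(\tau a_p^2b_q+\tau a_pb_q^2)=o_p(1),\quad \mathcal R_n''=O_p(\tau a_p^2b_q+\tau a_pb_q^2)=o_p(1).$$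 Thus the remainder term is of smaller order compared to the leading term and therefore is asymptotically negligible. (ii) When $k(x,y)=l(x,y)=|x-y|$, $$mdCov_n^2(\mathbf X,\mathbf Y)=\sqrt{pq}\,\sqrt{\binom n2}\;uCov_n^2(\mathbf X,\mathbf Y).$$
   Context: Setting. For each $p,q$, $(X,Y)$ is a pair of random vectors $X=(x_1,\dots,x_p)^T\in\mathbb R^p$, $Y=(y_1,\dots,y_q)^T\in\mathbb R^q$. $(X_1,Y_1),\dots,(X_n,Y_n)$ are i.i.d. copies of $(X,Y)$, with $X_s=(x_{s1},\dots,x_{sp})^T$, $Y_s=(y_{s1},\dots,y_{sq})^T$; $\mathbf X=(X_1,\dots,X_n)^T$, $\mathbf Y=(Y_1,\dots,Y_n)^T$; $\mathcal X_i=(x_{1i},\dots,x_{ni})^T$, $\mathcal Y_j=(y_{1j},\dots,y_{nj})^T$. $|\cdot|$ is the Euclidean norm; $(X',Y')$ is an independent copy of $(X,Y)$. $\mathcal U$-centering. For any matrix $\mathbf A=(a_{st})\in\mathbb R^{n\times n}$, $\widetilde{\mathbf A}=(\tilde a_{st})$ has $\tilde a_{ss}=0$ and, for $s\neq t$, $\tilde a_{st}=a_{st}-\frac1{n-2}\sum_{v=1}^na_{sv}-\frac1{n-2}\sum_{u=1}^na_{ut}+\frac1{(n-1)(n-2)}\sum_{u,v=1}^na_{uv}$; $(\widetilde{\mathbf A}\cdot\widetilde{\mathbf B})=\frac1{n(n-3)}\sum_{s\ne t}\tilde a_{st}\tilde b_{st}$. Statistics (all matrices below are $n\times n$ with entries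 indexed by $s,t=1,\dots,n$). - $dCov_n^2(\mathbf X,\mathbf Y)=(\widetilde{\mathbf A}\cdot\widetilde{\mathbf B})$, $a_{st}=|X_s-X_t|$, $b_{st}=|Y_s-Y_t|$. - $hCov_n^2(\mathbf X,\mathbf Y)=(\widetilde{\mathbf R}\cdot\widetilde{\mathbf H})$, $\mathbf R=(r_{st})$, $\mathbf H=(h_{st})$, $r_{st}=f(|X_s-X_t|/\gamma_{\mathbf X})$, $h_{st}=g(|Y_s-Y_t|/\gamma_{\mathbf Y})$, $\gamma_{\mathbf X}=\mathrm{median}\{|X_s-X_t|:s\ne t\}$, $\gamma_{\mathbf Y}=\mathrm{median}\{|Y_s-Y_t|:s\ne t\}$. Here $f,g$ are continuously differentiable functions with derivatives $f^{(1)},g^{(1)}$; they define kernels of the form $f(|x-y|/\gamma)$, $g(|x-y|/\gamma)$ with bandwidth $\gamma$, examples being the Gaussian kernel, $f(a)=\exp(-a^2/2)$, and the Laplacian kernel, $f(a)=\exp(-a)$. - $mdCov_n^2(\mathbf X,\mathbf Y)=\sqrt{\binom n2}\sum_{i=1}^p\sum_{j=1}^qdCov_n^2(\mathcal X_i,\mathcal Y_j)$, where $dCov_n^2(\mathcal X_i,\mathcal Y_j)=(\widetilde{\mathbf A}(i)\cdot\widetilde{\mathbf B}(j))$, with $\widetilde{\mathbf A}(i),\widetilde{\mathbf B}(j)$ the $\mathcal U$-centered versions of $\mathbf A(i)=(a_{st}(i))$, $\mathbf B(j)=(b_{st}(j))$, $a_{st}(i)=|x_{si}-x_{ti}|$,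 $b_{st}(j)=|y_{sj}-y_{tj}|$. - $uCov_n^2(\mathbf X,\mathbf Y)=\frac1{\sqrt{pq}}\sum_{i=1}^p\sum_{j=1}^q(\widetilde{\mathbf K}(i)\cdot\widetilde{\mathbf L}(j))$, where $\widetilde{\mathbf K}(i),\widetilde{\mathbf L}(j)$ are the $\mathcal U$-centered versions of $\mathbf K(i)=(k_{st}(i))$, $\mathbf L(j)=(l_{st}(j))$, and, for bivariate kernels $k,l$, $k_{st}(i)=k(x_{si},x_{ti})-E[k(x_{si},x_{ti})|x_{si}]-E[k(x_{si},x_{ti})|x_{ti}]+E[k(x_{si},x_{ti})]$, $l_{st}(j)=l(y_{sj},y_{tj})-E[l(y_{sj},y_{tj})|y_{sj}]-E[l(y_{sj},y_{tj})|y_{tj}]+E[l(y_{sj},y_{tj})]$. Notation: $\tau_X^2=E|X-X'|^2$, $\tau_Y^2=E|Y-Y'|^2$, $\tau=\tau_X\tau_Y$ (positive roots); $L_X(X,X')=\frac{|X-X'|^2-\tau_X^2}{\tau_X^2}$, $L_Y(Y,Y')=\frac{|Y-Y'|^2-\tau_Y^2}{\tau_Y^2}$.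
   Formalization: R and H are given zero diagonals in hCov (with f(0), g(0) there, hCov gains the bias f(0)g(0)/((n-1)(n-3)) and the claim on R_n'' fails), and the kernels f(|x-y|/γ), g(|x-y|/γ) are taken positive definite in every dimension; (ii) holds almost surely. *)

(* Defs.v *)
(* MathComp-Analysis, over an abstract [R : realType]. *)
From HB Require Import structures.
From mathcomp Require Import all_boot all_order all_algebra.
From mathcomp Require Import all_classical all_reals all_analysis.

Set Implicit Arguments.
Unset Strict Implicit.
Unset Printing Implicit Defensive.

Import Order.TTheory GRing.Theory Num.Theory.
Import numFieldNormedType.Exports.

Local Open Scope classical_set_scope.
Local Open Scope ring_scope.

(* Points of R^p are [p.-tuple R], which carries the product sigma-algebra. *)
Definition edist (R : realType) (p : nat) (x y : p.-tuple R) : R :=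
  Num.sqrt (\sum_(i < p) (tnth x i - tnth y i) ^+ 2).

Definition mutually_independent d d' (T : measurableType d)
    (U : measurableType d') (R : realType) (P : probability T R)
    (I : finType) (W : I -> T -> U) : Prop :=
  forall (J : {set I}) (A : I -> set U), (forall i, measurable (A i)) ->
    P [set w | forall i, i \in J -> A i (W i w)]
      = (\prod_(i in J) P (W i @^-1` A i))%E.

Definition same_law d d' (T : measurableType d) (U : measurableType d')
    (R : realType) (P : probability T R) (W W' : T -> U) : Prop :=
  forall A : set U, measurable A -> P (W @^-1` A) = P (W' @^-1` A).

Definition is_cexp d (T : measurableType d) (R : realType)
    (P : probability T R) (Z W V : T -> R) : Prop :=
  [/\ exists2 m : R -> R, measurable_fun [set: R] m & V = m \o Z,
      P.-integrable [set: T] (EFin \o V) &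
      forall B : set R, measurable B ->
        (\int[P]_(w in Z @^-1` B) (V w)%:E
         = \int[P]_(w in Z @^-1` B) (W w)%:E)%E].

(* A chosen version of E[W | Z]; it is determined P-almost surely (and is the
   zero function when no version exists, e.g. for non-integrable W). *)
Definition cexp d (T : measurableType d) (R : realType)
    (P : probability T R) (Z W : T -> R) : T -> R :=
  xget (cst 0) [set V | is_cexp P Z W V].

Definition ucenter (R : realType) (n : nat) (A : 'M[R]_n) : 'M[R]_n :=
  \matrix_(s, t)
    if s == t then 0
    else A s t - (n%:R - 2)^-1 * (\sum_(v < n) A s v)
               - (n%:R - 2)^-1 * (\sum_(u < n) A u t)
               + ((n%:R - 1) * (n%:R - 2))^-1
                 * (\sum_(u < n) \sum_(v < n) A u v).

Definition uprod (R : realType) (n : nat) (A B : 'M[R]_n) : R :=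
  (n%:R * (n%:R - 3))^-1
  * \sum_(s < n) \sum_(t < n | s != t) ucenter A s t * ucenter B s t.

Definition dCov2 (R : realType) (n p q : nat)
    (x : 'I_n -> p.-tuple R) (y : 'I_n -> q.-tuple R) : R :=
  uprod (\matrix_(s, t) edist (x s) (x t)) (\matrix_(s, t) edist (y s) (y t)).

(* Median of a finite multiset: the middle value, or the mean of the two
   middle values when the number of elements is even. *)
Definition median (R : realType) (l : seq R) : R :=
  let l' := sort <=%R l in
  (nth 0 l' (size l).-1./2 + nth 0 l' (size l)./2) / 2.

Definition bandwidth (R : realType) (n p : nat) (x : 'I_n -> p.-tuple R) : R :=
  median [seq edist (x st.1) (x st.2)
         | st <- enum [pred st : 'I_n * 'I_n | st.1 != st.2]].

(* The Gram matrix with zero diagonal, as in the unbiased HSIC estimator.  The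
   U-centering of a matrix with diagonal c and that of the same matrix with
   zero diagonal differ by the constant - c / (n - 1) off the diagonal; keeping
   f 0 and g 0 on the diagonals would therefore add the deterministic bias
   f 0 * g 0 / ((n - 1) * (n - 3)) to hCov2. *)
Definition kernel_mx (R : realType) (n p : nat) (f : R -> R)
    (x : 'I_n -> p.-tuple R) : 'M[R]_n :=
  \matrix_(s, t) if s == t then 0 else f (edist (x s) (x t) / bandwidth x).

Definition hCov2 (R : realType) (n p q : nat) (f g : R -> R)
    (x : 'I_n -> p.-tuple R) (y : 'I_n -> q.-tuple R) : R :=
  uprod (kernel_mx f x) (kernel_mx g y).

Definition mdCov2 (R : realType) (n p q : nat)
    (x : 'I_n -> p.-tuple R) (y : 'I_n -> q.-tuple R) : R :=
  Num.sqrt ('C(n, 2)%:R) *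
  \sum_(i < p) \sum_(j < q)
    uprod (\matrix_(s, t) `|tnth (x s) i - tnth (x t) i|)
          (\matrix_(s, t) `|tnth (y s) j - tnth (y t) j|).

Definition dcenter d (T : measurableType d) (R : realType)
    (P : probability T R) (k : R -> R -> R) (u v : T -> R) (w : T) : R :=
  let kuv := fun w' => k (u w') (v w') in
  kuv w - cexp P u kuv w - cexp P v kuv w + fine ('E_P[kuv])%E.

Definition uCov2 d (T : measurableType d) (R : realType)
    (P : probability T R) (n p q : nat) (k l : R -> R -> R)
    (x : 'I_n -> T -> p.-tuple R) (y : 'I_n -> T -> q.-tuple R) (w : T) : R :=
  (Num.sqrt (p%:R * q%:R))^-1 *
  \sum_(i < p) \sum_(j < q)
    uprod (\matrix_(s, t) dcenter P k (fun w' => tnth (x s w') i)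
                                      (fun w' => tnth (x t w') i) w)
          (\matrix_(s, t) dcenter P l (fun w' => tnth (y s w') j)
                                      (fun w' => tnth (y t w') j) w).

Definition tau2 d (T : measurableType d) (R : realType)
    (P : probability T R) (p : nat) (x x' : T -> p.-tuple R) : R :=
  fine ('E_P[fun w => (edist (x w) (x' w) ^+ 2)%R])%E.

Definition Ldist d (T : measurableType d) (R : realType)
    (P : probability T R) (p : nat) (x x' : T -> p.-tuple R) (w : T) : R :=
  (edist (x w) (x' w) ^+ 2 - tau2 P x x') / tau2 P x x'.

(* The regime min(p, q) -> oo. *)
Definition pq_oo : set_system (nat * nat) := filter_prod \oo \oo.

Definition bigOp (R : realType) (d : nat -> nat -> measure_display)
    (T : forall p q, measurableType (d p q))
    (P : forall p q, probability (T p q) R)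
    (Z : forall p q, T p q -> R) (c : nat -> nat -> R) : Prop :=
  forall e : R, 0 < e -> exists2 M : R, 0 < M &
    \forall pq \near pq_oo,
      (P pq.1 pq.2 [set w | (M * `|c pq.1 pq.2| < `|Z pq.1 pq.2 w|)%R]
       <= e%:E)%E.

Definition littleop (R : realType) (d : nat -> nat -> measure_display)
    (T : forall p q, measurableType (d p q))
    (P : forall p q, probability (T p q) R)
    (Z : forall p q, T p q -> R) (c : nat -> nat -> R) : Prop :=
  forall e : R, 0 < e ->
    (fun pq => P pq.1 pq.2 [set w | e * `|c pq.1 pq.2| < `|Z pq.1 pq.2 w|])
      @ pq_oo --> (0 : \bar R).

Definition littleo1 (R : realType) (c : nat -> nat -> R) : Prop :=
  (fun pq => c pq.1 pq.2) @ pq_oo --> (0 : R).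

Definition C1 (R : realType) (f : R -> R) : Prop :=
  (forall x : R, derivable f x 1) /\ continuous (f^`())%classic.

Definition pd_kernel (R : realType) (E : Type) (k : E -> E -> R) : Prop :=
  (forall x y, k x y = k y x) /\
  (forall (m : nat) (x : 'I_m -> E) (c : 'I_m -> R),
     0 <= \sum_(i < m) \sum_(j < m) c i * c j * k (x i) (x j)).

(* f defines kernels in every dimension and for every bandwidth.  For a general
   continuously differentiable f the first-order expansion of
   f (|x - y| / gamma) has no quadratic error term, whereas positive
   definiteness in all dimensions makes the derivative of f locally Lipschitz
   on the open half-line. *)
Definition radial_kernel (R : realType) (f : R -> R) : Prop :=
  forall (p : nat) (gamma : R), 0 < gamma ->
    pd_kernel (fun x y : p.-tuple R => f (edist x y / gamma)).

(* Main.v *)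
(* Let L_X(s, t) = (|X_s - X_t|^2 - tau_X^2) / tau_X^2 for s <> t.  U-centering
   annihilates matrices that are of the form m_s + m_t off the diagonal, so up to
   a null set the double centering in uCov is invisible, and for k = |x - y|^2
   the sums over coordinates give uCov = tau^2 / sqrt (pq) (L_X . L_Y), the dot
   being the product of U-centered matrices.  Taylor expansion of
   |X_s - X_t| = tau_X sqrt (1 + L_X(s, t)) and of f (|X_s - X_t| / gamma) at
   L_X = 0 gives the two leading terms; the constant term is annihilated and the
   quadratic errors produce the remainder.  On the event where all L_X(s, t) and
   L_Y(s, t) are of order a_p and b_q everything is deterministic, and the union
   bound controls the probability of its complement.

   A positive definite radial kernel f in all dimensions makes
   phi = f o sqrt satisfy phi >= 0, - Delta_h phi >= 0, Delta_h Delta_k phi >= 0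
   and - Delta_h Delta_k Delta_l phi >= 0; this forces phi' to be Lipschitz away
   from 0, which is the second-order Taylor estimate needed for hCov. *)
Require Import Defs.
From HB Require Import structures.
From mathcomp Require Import all_boot all_order all_algebra.
From mathcomp Require Import all_classical all_reals all_analysis.
From mathcomp Require Import measurable_realfun.
From mathcomp Require Import ring lra.

Set Implicit Arguments.
Unset Strict Implicit.
Unset Printing Implicit Defensive.

Import Order.TTheory GRing.Theory Num.Theory.
Import numFieldNormedType.Exports.

Local Open Scope classical_set_scope.
Local Open Scope ring_scope.

(** * Radial kernels that are positive definite in every dimension *)

(** The bandwidths are random, so the expansion point tau_X^2 / gamma^2 varies with the sample. Once
    all |L_X(s, t)| <= 1/2, the median is trapped between fixed multiples of tau_X, and a single
    Taylor constant for f o sqrt on [1/3, +oo) serves every outcome and every dimension. Conditional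
    expectations are chosen versions, known only almost surely. The remainders are therefore exact
    differences at every outcome, and their bounds hold off a null set, which tail probabilities do
    not see. After the constants are annihilated each factor has the form slope * L + Q with Q
    quadratic in L, and bilinearity leaves cross terms of orders a_p^2 b_q and a_p b_q^2. The rate
    of uCov needs one more input: its prefactor is tau^2 / sqrt (pq), and the second moment bounds
    give tau = O(sqrt (pq)). The sign conditions on differences of phi are obtained from finite
    configurations of points, with no integral representation of completely monotone functions. *)

Definition pd_sqdist (R : realType) (phi : R -> R) : Prop :=
  forall (p m : nat) (x : 'I_m -> 'I_p -> R) (c : 'I_m -> R),
    0 <= \sum_(i < m) \sum_(j < m)
           c i * c j * phi (\sum_(k < p) (x i k - x j k) ^+ 2).

Lemma radial_kernel_pd_sqdist (R : realType) (f : R -> R) :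
  radial_kernel f -> pd_sqdist (f \o Num.sqrt).
Proof.
move=> hf p m x c.
have [_ /(_ m (fun i => [tuple x i k | k < p]) c)] := hf p 1 ltr01.
set S := (X in 0 <= X) => h; set S' := (X in 0 <= X).
suff -> : S' = S by [].
apply: eq_bigr => i _; apply: eq_bigr => j _ /=; rewrite divr1 /Defs.edist.
by do 3 f_equal; apply: eq_bigr => k _; rewrite !tnth_mktuple.
Qed.

(* Average over [N + 1] points at mutual squared distance [s]; the diagonal
   contribution [phi 0] is negligible as [N] grows. *)
Lemma pd_sqdist_ge0 (R : realType) (phi : R -> R) (s : R) :
  pd_sqdist phi -> 0 <= s -> 0 <= phi s.
Proof.
move=> hphi s0; rewrite leNgt; apply/negP => ps.
(* With unit weights at the points [sqrt (s / 2)] times the basis vectors, the quadratic form equals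
   [(N + 1) * (phi 0 + N * phi s)]. *)
have H N : - phi s * N%:R <= phi 0.
  have := hphi N.+1 N.+1 (fun i k => (i == k)%:R * Num.sqrt (s / 2)) (fun=> 1).
  under eq_bigr => i _.
    rewrite (bigD1 i)//= !mulr1 mul1r.
    rewrite [X in phi X]big1; last by move=> k _; rewrite subrr expr0n.
    under eq_bigr => j ji.
      rewrite !mul1r (_ : \sum_(k < N.+1) _ = s); last first.
        rewrite (bigD1 i)//= (bigD1 j)//= big1 ?addr0; last first.
          move=> k /andP[ki kj].
          by rewrite eq_sym (negbTE ki) eq_sym (negbTE kj) !mul0r subrr expr0n.
        rewrite !eqxx (negbTE ji) eq_sym (negbTE ji) !mul1r !mul0r subr0 sub0r.
        by rewrite sqrrN sqr_sqrtr ?divr_ge0// -splitr.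
      over.
    rewrite sumr_const cardC1 card_ord /=.
    over.
  rewrite sumr_const card_ord pmulrn_lge0// -mulr_natr.
  lra.
have := archi_boundP (_ : 0 <= `|phi 0| / - phi s).
rewrite divr_ge0// ?oppr_ge0 ?(ltW ps)// => /(_ isT).
rewrite ltr_pdivrMr ?oppr_gt0// => h.
have := H (Num.bound (`|phi 0| / - phi s)); rewrite mulrC leNgt => /negP; apply.
by apply: le_lt_trans h; exact: ler_norm.
Qed.

(* Double every point: a copy of weight [- c] shifted by [sqrt h] along a new
   coordinate. *)
Lemma pd_sqdistB (R : realType) (phi : R -> R) (h : R) :
  pd_sqdist phi -> 0 <= h -> pd_sqdist (fun s => phi s - phi (s + h)).
Proof.
move=> hphi h0 p m x c.
pose x' (i : 'I_(m + m)) (k : 'I_p.+1) : R := match fintype.split i, unlift ord0 k with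
  | inl i, Some k => x i k | inr i, Some k => x i k
  | inl _, None => 0 | inr _, None => Num.sqrt h end.
pose c' (i : 'I_(m + m)) : R :=
  match fintype.split i with inl i => c i | inr i => - c i end.
have := hphi p.+1 (m + m)%N x' c'.
have spl i : fintype.split (lshift m i) = inl i by exact: (unsplitK (inl i)).
have spr i : fintype.split (rshift m i) = inr i by exact: (unsplitK (inr i)).
have xl i k : x' (lshift m i) (lift ord0 k) = x i k by rewrite /x' spl liftK.
have xr i k : x' (rshift m i) (lift ord0 k) = x i k by rewrite /x' spr liftK.
have dist i' j' i j : (forall k, x' i' (lift ord0 k) = x i k) ->
    (forall k, x' j' (lift ord0 k) = x j k) ->
    \sum_(k < p.+1) (x' i' k - x' j' k) ^+ 2 =
    (x' i' ord0 - x' j' ord0) ^+ 2 + \sum_(k < p) (x i k - x j k) ^+ 2.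
  move=> hi hj; rewrite big_ord_recl; congr (_ + _).
  by apply: eq_bigr => k _; rewrite hi hj.
have E : \sum_(i < m + m) \sum_(j < m + m)
      c' i * c' j * phi (\sum_(k < p.+1) (x' i k - x' j k) ^+ 2) =
   (\sum_(i < m) \sum_(j < m) c i * c j *
     (phi (\sum_(k < p) (x i k - x j k) ^+ 2)
      - phi (\sum_(k < p) (x i k - x j k) ^+ 2 + h))) *+ 2.
  rewrite big_split_ord /= -!big_split /= -sumrMnl; apply: eq_bigr => i _.
  rewrite !big_split_ord /= -!big_split /= -sumrMnl; apply: eq_bigr => j _.
  rewrite (dist _ _ i j (xl i) (xl j)) (dist _ _ i j (xl i) (xr j)).
  rewrite (dist _ _ i j (xr i) (xl j)) (dist _ _ i j (xr i) (xr j)).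
  rewrite /c' /x' !spl !spr unlift_none.
  rewrite !subr0 sub0r sqrrN subrr expr0n /= sqr_sqrtr// !add0r.
  rewrite [h + _]addrC; ring.
by rewrite E pmulrn_lge0.
Qed.

Lemma pd_sqdist_le (R : realType) (phi : R -> R) (s t : R) :
  pd_sqdist phi -> 0 <= s -> s <= t -> phi t <= phi s.
Proof.
move=> hphi s0 st; rewrite -subr_ge0.
have hk : 0 <= t - s by rewrite subr_ge0.
by have := pd_sqdist_ge0 (pd_sqdistB hphi hk) s0; rewrite [s + _]addrC subrK.
Qed.

Lemma pd_sqdist_derive_le0 (R : realType) (phi dphi : R -> R) (s : R) :
  pd_sqdist phi -> (forall s : R, 0 < s -> is_derive s 1 phi (dphi s)) ->
  0 < s -> dphi s <= 0.
Proof.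
move=> hphi dP s0.
apply/ler_addgt0Pl => e e0; rewrite addr0 -subr_le0.
(* The tilt by [e * x] turns weak into strict monotonicity, as the derivative criterion below asks;
   [e] is arbitrarily small. *)
pose chi x := phi x - e * x.
have dC (x : R) : 0 < x -> is_derive x 1 chi (dphi x - e).
  move=> x0; have dx := dP _ x0.
  have : is_derive x 1 chi (dphi x - e *: 1) by exact: is_deriveB.
  by rewrite /GRing.scale/= mulr1.
have <- : (chi^`())%classic s = dphi s - e.
  by rewrite derive1E; have [] := dC _ s0.
apply: (@decr_derive1_le0_itvy _ chi true 0) => [x|x y|].
- by rewrite inE/= in_itv/= andbT => /dC [].
- rewrite !in_itv/= !andbT => x0 y0 yx.
  have := pd_sqdist_le hphi y0 (ltW yx).
  have : e * y < e * x by rewrite ltr_pM2l.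
  by rewrite /chi; lra.
- by rewrite in_itv/= andbT.
Qed.

Lemma MVT_gt0 (R : realType) (phi dphi : R -> R) (s t : R) :
  (forall s : R, 0 < s -> is_derive s 1 phi (dphi s)) ->
  0 < s -> s < t ->
  exists2 c, s < c < t & phi t - phi s = dphi c * (t - s).
Proof.
move=> dP s0 st.
have der x : x \in `]s, t[%R -> is_derive x 1 phi (dphi x).
  by move=> /[!in_itv]/= /andP[sx _]; apply: dP; exact: lt_trans sx.
have cts : {within `[s, t], continuous phi}.
  apply: derivable_within_continuous => x /[!in_itv]/= /andP[sx _].
  by have [] := dP _ (lt_le_trans s0 sx).
by have [c cst ->] := MVT st der cts; exists c => //; move: cst; rewrite in_itv.
Qed.

Lemma is_derive_shiftB (R : realType) (phi dphi : R -> R) (h : R) :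
  0 <= h -> (forall s : R, 0 < s -> is_derive s 1 phi (dphi s)) ->
  forall s : R, 0 < s ->
    is_derive s 1 (fun s => phi s - phi (s + h)) (dphi s - dphi (s + h)).
Proof.
move=> h0 dP s s0; apply: is_deriveB; first exact: dP.
have dh : is_derive s 1 (fun x : R => x + h) (1 + 0) by exact: is_deriveD.
have ds := dP (s + h) (ltr_wpDr h0 s0).
have := @is_derive1_comp _ phi (fun x : R => x + h) s _ _ ds dh.
by rewrite addr0 mulr1.
Qed.

(* [psi = phi - phi (. + h)] is itself positive definite, so [psi'] is
   nonpositive and nondecreasing; hence
   [(s / 2) (- psi' s) <= psi (s / 2) - psi s <= psi (s / 2) <= - h phi' (s / 2)]. *)
Lemma pd_sqdist_derive_lipschitz (R : realType) (phi dphi : R -> R) (s h : R) :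
  pd_sqdist phi -> (forall s : R, 0 < s -> is_derive s 1 phi (dphi s)) ->
  0 < s -> 0 <= h ->
  0 <= dphi (s + h) - dphi s <= 2 / s * - dphi (s / 2) * h.
Proof.
move=> hphi dP s0; rewrite le_eqVlt => /predU1P[<-|h0].
  by rewrite addr0 subrr mulr0 lexx.
(* Convexity of [phi]: with [k = y - x], the difference [phi - phi (. + k)] is positive definite, so
   its derivative at [x] is nonpositive. The same argument applied to [psi] gives [dpnd]. *)
have dnd x y : 0 < x -> x <= y -> dphi x <= dphi y.
  move=> x0 xy; have hk : 0 <= y - x by rewrite subr_ge0.
  have := @pd_sqdist_derive_le0 _ _ _ x (pd_sqdistB hphi hk)
    (is_derive_shiftB hk dP) x0.
  by rewrite [x + _]addrC subrK subr_le0.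
pose psi s := phi s - phi (s + h); pose dpsi s := dphi s - dphi (s + h).
have dpP : forall s : R, 0 < s -> is_derive s 1 psi (dpsi s).
  exact: is_derive_shiftB (ltW h0) dP.
have hpsi : pd_sqdist psi by exact: pd_sqdistB hphi (ltW h0).
have dpnd x y : 0 < x -> x <= y -> dpsi x <= dpsi y.
  move=> x0 xy; have hk : 0 <= y - x by rewrite subr_ge0.
  have := @pd_sqdist_derive_le0 _ _ _ x (pd_sqdistB hpsi hk)
    (is_derive_shiftB hk dpP) x0.
  by rewrite [x + _]addrC subrK subr_le0.
have s20 : 0 < s / 2 by rewrite divr_gt0.
have s2s : s / 2 < s by lra.
have [x /andP[sx xs] Ex] := MVT_gt0 dpP s20 s2s.
have := @MVT_gt0 _ _ _ (s / 2) (s / 2 + h) dP s20.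
rewrite ltrDl => /(_ h0)[y /andP[sy ys] Ey].
have psis : 0 <= psi s by exact: pd_sqdist_ge0 hpsi (ltW s0).
have Hx : dpsi x <= dpsi s by apply: dpnd (ltW xs); lra.
have Hy : dphi (s / 2) <= dphi y by exact: dnd (ltW sy).
apply/andP; split; first by rewrite subr_ge0 dnd//; lra.
have E1 : psi s - psi (s / 2) <= dpsi s * (s / 2).
  rewrite Ex (_ : s - s / 2 = s / 2); last by field.
  by rewrite ler_wpM2r// ltW.
have E2 : psi (s / 2) <= - dphi (s / 2) * h.
  have -> : psi (s / 2) = - (dphi y * (s / 2 + h - s / 2)).
    by rewrite -Ey /psi opprB.
  by rewrite [s / 2 + h]addrC addrK mulNr lerN2 ler_wpM2r// ltW.
have E3 : - dpsi s * (s / 2) <= - dphi (s / 2) * h by lra.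
have -> : dphi (s + h) - dphi s = - dpsi s by rewrite /dpsi opprB.
rewrite (_ : 2 / s * _ * h = (- dphi (s / 2) * h) / (s / 2)); last by field; lra.
by rewrite ler_pdivlMr.
Qed.

(** The local Lipschitz constant [2 / s * - dphi (s / 2)] of the derivative decreases in [s], so its
    value at [c] works on the whole half-line; the mean value theorem then gives a quadratic
    error. *)
Lemma pd_sqdist_taylor (R : realType) (phi dphi : R -> R) (c : R) :
  pd_sqdist phi -> (forall s : R, 0 < s -> is_derive s 1 phi (dphi s)) -> 0 < c ->
  exists2 K, 0 <= K & forall s t, c <= s -> c <= t ->
    `|phi t - phi s - dphi s * (t - s)| <= K * (t - s) ^+ 2 /\ `|dphi s| <= K.
Proof.
move=> hphi dP c0.
have c20 : 0 < c / 2 by rewrite divr_gt0.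
have D0 s : 0 < s -> dphi s <= 0 by exact: pd_sqdist_derive_le0 hphi dP.
have Dnd s t : 0 < s -> s <= t -> dphi s <= dphi t.
  move=> s0 st; have hk : 0 <= t - s by rewrite subr_ge0.
  have /andP[+ _] := pd_sqdist_derive_lipschitz hphi dP s0 hk.
  by rewrite [s + _]addrC subrK subr_ge0.
pose L := 2 / c * - dphi (c / 2).
have L0 : 0 <= L by rewrite mulr_ge0 ?divr_ge0 ?oppr_ge0 ?D0 ?(ltW c0).
have lip s t : c <= s -> s <= t -> `|dphi t - dphi s| <= L * (t - s).
  move=> cs st; have s0 := lt_le_trans c0 cs.
  have hk : 0 <= t - s by rewrite subr_ge0.
  have /andP[+ H2] := pd_sqdist_derive_lipschitz hphi dP s0 hk.
  rewrite [s + _]addrC subrK in H2 * => H1; rewrite ger0_norm//.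
  apply: le_trans H2 _; rewrite ler_wpM2r// ler_pM//.
  - by rewrite divr_ge0// ltW.
  - by rewrite oppr_ge0 D0// divr_gt0.
  - by rewrite ler_pM2l// lef_pV2// posrE.
  - by rewrite lerN2 Dnd// ler_pM2r.
(* [L] controls the quadratic error, and [- dphi c] bounds the slope because [dphi] is nonpositive
   and nondecreasing; their sum serves for both. *)
exists (L - dphi c); first by rewrite subr_ge0 (le_trans (D0 _ c0)).
move=> s t cs ct; have s0 := lt_le_trans c0 cs; split; last first.
  have := Dnd _ _ c0 cs; have := D0 _ s0; move=> h1 h2.
  rewrite ler0_norm//; lra.
have T0 : 0 <= (t - s) ^+ 2 by exact: sqr_ge0.
suff : `|phi t - phi s - dphi s * (t - s)| <= L * (t - s) ^+ 2.
  move=> /le_trans; apply; rewrite ler_wpM2r// lerDl oppr_ge0; exact: D0.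
have t0 := lt_le_trans c0 ct.
have [st|ts|->] := ltgtP s t; last by rewrite !subrr mulr0 subrr normr0 expr0n mulr0.
- have [x /andP[sx xt] ->] := MVT_gt0 dP s0 st.
  rewrite -mulrBl normrM (gtr0_norm (_ : 0 < t - s)) ?subr_gt0// expr2 mulrA.
  apply: ler_wpM2r; first by rewrite subr_ge0 ltW.
  apply: le_trans (lip _ _ cs (ltW sx)) _.
  by rewrite ler_wpM2l// lerB// ltW.
- have [x /andP[tx xs] E] := MVT_gt0 dP t0 ts.
  have -> : phi t - phi s - dphi s * (t - s) = (dphi s - dphi x) * (s - t).
    by rewrite mulrBl -E; ring.
  rewrite normrM (gtr0_norm (_ : 0 < s - t)) ?subr_gt0//.
  rewrite (_ : (t - s) ^+ 2 = (s - t) * (s - t)); last by ring.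
  rewrite mulrA; apply: ler_wpM2r; first by rewrite subr_ge0 ltW.
  apply: le_trans (lip _ _ (le_trans ct (ltW tx)) (ltW xs)) _.
  by rewrite ler_wpM2l// lerB// ltW.
Qed.

Lemma radial_kernel_taylor (R : realType) (f : R -> R) (c : R) :
  C1 f -> radial_kernel f -> 0 < c ->
  exists2 K, 0 <= K & forall s t, c <= s -> c <= t ->
    `|f (Num.sqrt t) - f (Num.sqrt s)
       - (f^`())%classic (Num.sqrt s) / (2 * Num.sqrt s) * (t - s)|
      <= K * (t - s) ^+ 2 /\
    `|(f^`())%classic (Num.sqrt s) / (2 * Num.sqrt s)| <= K.
Proof.
move=> [df _] /radial_kernel_pd_sqdist hf c0.
apply: (@pd_sqdist_taylor _ (f \o Num.sqrt)
  (fun s => (f^`())%classic (Num.sqrt s) / (2 * Num.sqrt s)) c hf) => // s s0.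
have ds := is_derive1_sqrt s0.
have df' : is_derive (Num.sqrt s) 1 f ((f^`())%classic (Num.sqrt s)).
  by rewrite derive1E; apply: DeriveDef; first exact: df.
exact: @is_derive1_comp _ f Num.sqrt s _ _ df' ds.
Qed.

(** * U-centering *)

Lemma ucenter_is_linear (R : realType) (n : nat) : linear (@ucenter R n).
Proof.
move=> c A B; apply/matrixP => s t; rewrite !mxE; case: eqP => _.
  by rewrite mulr0 addr0.
have rowE s' : \sum_(v < n) (c *: A + B) s' v
    = c * \sum_(v < n) A s' v + \sum_(v < n) B s' v.
  by rewrite mulr_sumr -big_split; apply: eq_bigr => v _; rewrite !mxE.
have -> : \sum_(u < n) (c *: A + B) u t
    = c * \sum_(u < n) A u t + \sum_(u < n) B u t.
  by rewrite mulr_sumr -big_split; apply: eq_bigr => v _; rewrite !mxE.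
rewrite (eq_bigr _ (fun u _ => rowE u)).
rewrite rowE big_split /= -mulr_sumr; ring.
Qed.

HB.instance Definition _ (R : realType) (n : nat) :=
  GRing.isLinear.Build R 'M[R]_n 'M[R]_n *:%R (@ucenter R n)
    (@ucenter_is_linear R n).

(** The row sums in the U-centering run over the diagonal too, so annihilation of additive matrices
    depends on the zero diagonal. *)
Definition hollow (R : realType) (n : nat) (F : 'I_n -> 'I_n -> R) : 'M[R]_n :=
  \matrix_(s, t) if s == t then 0 else F s t.

(** Without its diagonal entry, row [a] sums to [(n - 2) * m a + S], where [S] is the sum of [m],
    and all entries sum to [2 * (n - 1) * S]. The weights of the U-centering are exactly those that
    cancel these. *)
Lemma ucenter_hollowD (R : realType) (n : nat) (m : 'I_n -> R) :
  (3 <= n)%N -> ucenter (hollow (fun s t => m s + m t)) = 0.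
Proof.
move=> n3; apply/matrixP => s t; rewrite !mxE; case: (eqVneq s t) => [//|st].
set S := \sum_(v < n) m v.
have H a : \sum_(v < n) (m a + m v) = n%:R * m a + S.
  by rewrite big_split /= sumr_const card_ord mulr_natl.
have rowE a : \sum_(v < n) hollow (fun s t => m s + m t) a v
    = (n%:R - 2) * m a + S.
  rewrite (bigD1 a)//= mxE eqxx add0r.
  rewrite (eq_bigr (fun v => m a + m v)) => [|v va].
    by have := H a; rewrite (bigD1 a)//= => E; rewrite mulrBl; lra.
  by rewrite mxE eq_sym (negbTE va).
have colE b : \sum_(u < n) hollow (fun s t => m s + m t) u b
    = (n%:R - 2) * m b + S.
  rewrite -rowE; apply: eq_bigr => u _; rewrite !mxE eq_sym.
  by case: eqP => // _; rewrite addrC.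
rewrite rowE colE; under eq_bigr do rewrite rowE.
rewrite big_split /= -mulr_sumr -/S sumr_const card_ord -(mulr_natl S).
have n1 : n%:R - 1 != 0 :> R by rewrite subr_eq0 pnatr_eq1 gtn_eqF// (ltn_trans _ n3).
have n2 : n%:R - 2 != 0 :> R by rewrite subr_eq0 eqr_nat gtn_eqF.
by field; rewrite n1 n2.
Qed.

Lemma uprodC (R : realType) (n : nat) (A B : 'M[R]_n) : uprod A B = uprod B A.
Proof.
congr (_ * _); apply: eq_bigr => s _; apply: eq_bigr => t _; exact: mulrC.
Qed.

Lemma uprod_ucenter (R : realType) (n : nat) (A A' B B' : 'M[R]_n) :
  ucenter A = ucenter A' -> ucenter B = ucenter B' -> uprod A B = uprod A' B'.
Proof. by rewrite /uprod => -> ->. Qed.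

Lemma uprodDl (R : realType) (n : nat) (A A' B : 'M[R]_n) :
  uprod (A + A') B = uprod A B + uprod A' B.
Proof.
rewrite /uprod -mulrDr -big_split; congr (_ * _); apply: eq_bigr => s _ /=.
rewrite -big_split; apply: eq_bigr => t _ /=.
by rewrite linearD mxE mulrDl.
Qed.

Lemma uprodZl (R : realType) (n : nat) c (A B : 'M[R]_n) :
  uprod (c *: A) B = c * uprod A B.
Proof.
rewrite /uprod mulrCA; congr (_ * _); rewrite mulr_sumr.
apply: eq_bigr => s _; rewrite mulr_sumr; apply: eq_bigr => t _.
by rewrite linearZ mxE mulrA.
Qed.

Lemma uprodDr (R : realType) (n : nat) (A B B' : 'M[R]_n) :
  uprod A (B + B') = uprod A B + uprod A B'.
Proof. by rewrite uprodC uprodDl !(uprodC _ A). Qed.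

Lemma uprodZr (R : realType) (n : nat) c (A B : 'M[R]_n) :
  uprod A (c *: B) = c * uprod A B.
Proof. by rewrite uprodC uprodZl uprodC. Qed.

Lemma uprod_suml (R : realType) (n : nat) I (r : seq I) (A : I -> 'M[R]_n) B :
  uprod (\sum_(i <- r) A i) B = \sum_(i <- r) uprod (A i) B.
Proof.
elim: r => [|i r IH]; last by rewrite !big_cons uprodDl IH.
by rewrite !big_nil -(scale0r (0 : 'M[R]_n)) uprodZl mul0r.
Qed.

Lemma uprod_sumr (R : realType) (n : nat) I (r : seq I) (B : I -> 'M[R]_n) A :
  uprod A (\sum_(i <- r) B i) = \sum_(i <- r) uprod A (B i).
Proof. by rewrite uprodC uprod_suml; apply: eq_bigr => i _; rewrite uprodC. Qed.

(** The factor is 8 = 1 + 2 + 2 + 3: for [n >= 4], n / (n - 2) <= 2 and n^2 / ((n - 1)(n - 2)) <=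
    3. *)
Lemma ucenter_le (R : realType) (n : nat) (A : 'M[R]_n) (e : R) :
  (4 <= n)%N -> (forall s t, `|A s t| <= e) ->
  forall s t, `|ucenter A s t| <= 8 * e.
Proof.
move=> n4 hA s t; have e0 : 0 <= e by rewrite (le_trans _ (hA s t)).
have hn : 4 <= n%:R :> R by rewrite ler_nat.
have S1 (F : 'I_n -> R) x : (forall v, `|F v| <= x) ->
    `|\sum_(v < n) F v| <= n%:R * x.
  move=> hF; apply: le_trans (ler_norm_sum _ _ _) _.
  apply: (@le_trans _ _ (\sum_(v < n) x)); first exact: ler_sum.
  by rewrite sumr_const card_ord mulr_natl.
have r1 := S1 _ _ (hA s); have r2 := S1 _ _ (hA ^~ t).
have r3 := S1 _ _ (fun u => S1 _ _ (hA u)).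
have n2 : 0 < n%:R - 2 :> R by lra.
have n1 : 0 < n%:R - 1 :> R by lra.
have q1 : (n%:R - 2)^-1 * (n%:R * e) <= 2 * e.
  by rewrite mulrA ler_wpM2r// mulrC ler_pdivrMr//; lra.
have q3 : ((n%:R - 1) * (n%:R - 2))^-1 * (n%:R * (n%:R * e)) <= 3 * e.
  rewrite (_ : _ * _ = n%:R * n%:R / ((n%:R - 1) * (n%:R - 2)) * e); last by ring.
  rewrite ler_wpM2r// ler_pdivrMr ?mulr_gt0//.
  by have := sqr_ge0 (n%:R - 4 : R); nra.
rewrite !mxE; case: eqP => _; first by rewrite normr0 mulr_ge0.
have w1 (x y c : R) : 0 <= c -> `|x| <= y -> `|c * x| <= c * y.
  by move=> c0 xy; rewrite normrM ger0_norm// ler_wpM2l.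
apply: le_trans (ler_normD _ _) _.
have i1 : 0 <= (n%:R - 2)^-1 :> R by rewrite invr_ge0 ltW.
have i3 : 0 <= ((n%:R - 1) * (n%:R - 2))^-1 :> R.
  by rewrite invr_ge0 mulr_ge0 // ltW.
have h1 := le_trans (w1 _ _ _ i1 r1) q1.
have h2 := le_trans (w1 _ _ _ i1 r2) q1.
have h3 := le_trans (w1 _ _ _ i3 r3) q3.
apply: le_trans (lerD (le_trans (ler_normB _ _) (lerD (ler_normB _ _) (lexx _)))
  (lexx _)) _.
by have := hA s t; lra.
Qed.

(** There are at most [n * n] summands, and 64 = 8 * 8 comes from [ucenter_le] on each factor. As
    [n] is fixed, this is a constant in the asymptotics. *)
Definition uprod_cst (R : realType) (n : nat) : R :=
  `|(n%:R * (n%:R - 3))^-1| * (n%:R * (n%:R * 64)).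

Lemma uprod_cst_ge0 (R : realType) (n : nat) : 0 <= uprod_cst R n.
Proof. by rewrite !mulr_ge0. Qed.

Lemma uprod_le (R : realType) (n : nat) (A B : 'M[R]_n) (e e' : R) :
  (4 <= n)%N -> 0 <= e -> 0 <= e' ->
  (forall s t, `|A s t| <= e) -> (forall s t, `|B s t| <= e') ->
  `|uprod A B| <= uprod_cst R n * (e * e').
Proof.
move=> n4 e0 e0' hA hB; rewrite normrM /uprod_cst -!mulrA ler_wpM2l//.
apply: le_trans (ler_norm_sum _ _ _) _.
have -> : n%:R * (n%:R * (64 * (e * e')))
    = \sum_(s < n) \sum_(t < n) ((8 * e) * (8 * e')).
  by rewrite !sumr_const card_ord -mulrnA -[RHS]mulr_natl natrM; ring.
apply: ler_sum => s _; apply: le_trans (ler_norm_sum _ _ _) _.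
rewrite big_mkcond/=; apply: ler_sum => t _.
case: ifP => _; last by rewrite !mulr_ge0.
by rewrite normrM ler_pM// ucenter_le.
Qed.

Lemma uprod_expansion (R : realType) (n : nat) (al al' be be' : R)
    (L L' Q Q' : 'M[R]_n) (e e' K : R) :
  (4 <= n)%N -> 0 <= e <= 1 -> 0 <= e' <= 1 -> 0 <= K ->
  (forall s t, `|L s t| <= e) -> (forall s t, `|L' s t| <= e') ->
  (forall s t, `|Q s t| <= K * e ^+ 2) ->
  (forall s t, `|Q' s t| <= K * e' ^+ 2) ->
  `|be| <= K -> `|be'| <= K ->
  `|uprod (al *: hollow (fun _ _ => 1) + (be *: L + Q))
          (al' *: hollow (fun _ _ => 1) + (be' *: L' + Q'))
    - be * be' * uprod L L'|
  <= uprod_cst R n * (2 * K ^+ 2) * (e ^+ 2 * e' + e * e' ^+ 2).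
Proof.
move=> n4 /andP[e0 e1] /andP[e0' e1'] K0 hL hL' hQ hQ' hb hb'.
(* The constant 1 is additive with [m = 1 / 2]. *)
have uJ : ucenter (hollow (fun _ _ : 'I_n => 1)) = 0 :> 'M[R]_n.
  rewrite -(@ucenter_hollowD R n (fun=> 2^-1)) 1?ltnW//; congr ucenter.
  by apply/matrixP => s t; rewrite !mxE; case: eqP => // _; lra.
have J0 (c : R) (M : 'M[R]_n) : ucenter (c *: hollow (fun _ _ => 1) + M) = ucenter M.
  by rewrite linearD linearZ /= uJ scaler0 add0r.
rewrite (uprod_ucenter (J0 _ _) (J0 _ _)) !(uprodDl, uprodDr, uprodZl, uprodZr).
rewrite [X in `|X|](_ : _ = be * uprod L Q' + be' * uprod Q L' + uprod Q Q').
  2: by ring.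
set C := uprod_cst R n; have C0 : 0 <= C := uprod_cst_ge0 R n.
have e20 := sqr_ge0 e; have e20' := sqr_ge0 e'.
have h1 : `|be * uprod L Q'| <= K * (C * (e * (K * e' ^+ 2))).
  by rewrite normrM ler_pM// uprod_le// mulr_ge0.
have h2 : `|be' * uprod Q L'| <= K * (C * ((K * e ^+ 2) * e')).
  by rewrite normrM ler_pM// uprod_le// mulr_ge0.
have h3 : `|uprod Q Q'| <= C * ((K * e ^+ 2) * (K * e' ^+ 2)).
  by rewrite uprod_le// mulr_ge0.
apply: le_trans (ler_normD _ _) _; apply: le_trans (lerD (ler_normD _ _) (lexx _)) _.
apply: le_trans (lerD (lerD h1 h2) h3) _.
have CK : 0 <= C * K ^+ 2 by rewrite mulr_ge0// sqr_ge0.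
(* The product of both quadratic errors is absorbed in a mixed term since [e' <= 1]; this is where
   the factor 2 in the bound arises. *)
have h4 : e ^+ 2 * e' ^+ 2 <= e ^+ 2 * e' by rewrite ler_wpM2l// expr2 ler_piMr.
rewrite -subr_ge0 (_ : _ - _ = C * K ^+ 2 * (e ^+ 2 * e' + e * e' ^+ 2
  - e ^+ 2 * e' ^+ 2)); last by ring.
have h5 : 0 <= e * e' ^+ 2 by rewrite mulr_ge0.
by apply: mulr_ge0 => //; lra.
Qed.

(** * Measurability of the statistics *)

Lemma median_itv (R : realType) (l : seq R) (lo hi : R) :
  (0 < size l)%N -> {in l, forall x, lo <= x <= hi} -> lo <= median l <= hi.
Proof.
move=> l0 hl; have H k : (k < size l)%N -> lo <= nth 0 (sort <=%R l) k <= hi.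
  by move=> kl; apply: hl; rewrite -(mem_sort <=%R) mem_nth ?size_sort.
have s2 : ((size l)./2 < size l)%N by rewrite -divn2 ltn_Pdiv.
have /andP[a1 a2] := H _ (leq_ltn_trans (half_leq (leq_pred _)) s2).
have /andP[b1 b2] := H _ s2.
by rewrite /median ler_pdivlMr// ler_pdivrMr// !mulr_natr !mulr2n !lerD.
Qed.

(** Expressing an order statistic by counting removes the sorting permutation: the event depends
    only on which entries lie below [c], and measurability follows by recursion on the list. *)
Lemma ltr_nth_sort (R : realType) (l : seq R) (k : nat) (c : R) :
  (k < size l)%N -> (nth 0 (sort <=%R l) k < c) = (k < count (< c)%R l)%N.
Proof.
move=> kl; rewrite -(permP (permEl (perm_sort <=%R l)) (< c)%R).
have ss : sorted <=%R (sort <=%R l) by exact/sort_sorted/le_total.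
apply/idP/idP; last exact: nth_count_lt.
apply: contraTT; rewrite -!leNgt -leqNgt => h.
by apply: nth_count_ge => //; rewrite h size_sort.
Qed.

Lemma measurable_count_gt d (T : measurableType d) (R : realType) (I : Type)
    (F : I -> T -> R) (l : seq I) (c : R) (k : nat) :
  (forall i, measurable_fun setT (F i)) ->
  measurable [set w | (k < count (< c)%R [seq F i w | i <- l])%N].
Proof.
move=> mF; elim: l k => [|i l IH] k /=.
  by rewrite [X in measurable X](_ : _ = set0)// -subset0 => w /=; rewrite ltn0.
have mFc : measurable [set w | F i w < c].
  rewrite -[X in measurable X]setTI; have := mF i measurableT `]-oo, c[%classic.
  by rewrite preimage_itvNyo; apply; exact: measurable_itv.
(* Either the tail already has more than [k] entries below [c], or the head is below [c] and the
   tail needs one fewer. As [0.-1 = 0], the case [k = 0], where the tail is unconstrained, needs its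
   own disjunct. *)
rewrite [X in measurable X](_ : _ =
  [set w | (k < count (< c)%R [seq F i w | i <- l])%N] `|`
  ([set w | F i w < c] `&`
   [set w | (k.-1 < count (< c)%R [seq F i w | i <- l])%N \/ k = 0%N])).
- apply: measurableU; first exact: IH.
  apply: measurableI => //.
  have [->|k0] := eqVneq k 0%N.
    by rewrite [X in measurable X](_ : _ = setT)//; apply/seteqP; split => // w _; right.
  rewrite [X in measurable X](_ : _ =
    [set w | (k.-1 < count (< c)%R [seq F i w | i <- l])%N]); first exact: IH.
  apply/seteqP; split => w /=; last by left.
  by case=> // k0'; rewrite k0' in k0.
- apply/seteqP; split => w /=.
    case: (F i w < c) => /=; last by rewrite add0n; left.
    rewrite add1n ltnS => h; right; split => //.
    by case: k h => [|k] h; [right|left].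
  case=> [h|[->]]; first by rewrite (leq_trans h)// leq_addl.
  by rewrite add1n ltnS; case=> [|->//]; case: k.
Qed.

Lemma measurable_nth_sort d (T : measurableType d) (R : realType) (I : Type)
    (F : I -> T -> R) (l : seq I) (k : nat) :
  (forall i, measurable_fun setT (F i)) ->
  measurable_fun setT (fun w => nth 0 (sort <=%R [seq F i w | i <- l]) k).
Proof.
move=> mF; have [kl|lk] := ltnP k (size l); last first.
  rewrite [X in measurable_fun _ X](_ : _ = cst 0)//; apply/funext => w.
  by rewrite nth_default// size_sort size_map.
move=> mD; apply: (measurability _ (RGenInftyO.measurableE R)) => //.
move=> _ [_ [c ->] <-]; rewrite setTI preimage_itvNyo.
rewrite [X in measurable X](_ : _ =
  [set w | (k < count (< c)%R [seq F i w | i <- l])%N]).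
  exact: measurable_count_gt.
apply/seteqP; split => w /=; by rewrite ltr_nth_sort// size_map.
Qed.

Lemma measurable_median d (T : measurableType d) (R : realType) (I : Type)
    (F : I -> T -> R) (l : seq I) :
  (forall i, measurable_fun setT (F i)) ->
  measurable_fun setT (fun w => median [seq F i w | i <- l]).
Proof.
move=> mF; rewrite /median; apply: measurable_funM => //.
under eq_fun do rewrite size_map.
by apply: measurable_funD; exact: measurable_nth_sort.
Qed.

Lemma measurable_invr (R : realType) : measurable_fun setT (@GRing.inv R).
Proof.
rewrite (_ : GRing.inv = fun x => x * (x ^+ 2) `^ (-1)).
  apply: measurable_funM => //.
  apply: (@measurableT_comp _ _ _ _ _ _ (@powR R ^~ (-1))).
    exact: measurable_powR.
  exact: measurable_funX.
apply/funext => x; rewrite powR_inv1 ?sqr_ge0//.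
have [->|x0] := eqVneq x 0; first by rewrite invr0 mul0r.
by rewrite expr2 invfM mulrA divff// mul1r.
Qed.

Lemma measurable_edist d (T : measurableType d) (R : realType) (p : nat)
    (x y : T -> p.-tuple R) :
  measurable_fun setT x -> measurable_fun setT y ->
  measurable_fun setT (fun w => Defs.edist (x w) (y w)).
Proof.
move=> mx my; apply: (@measurableT_comp _ _ _ _ _ _ (@Num.sqrt R)).
  by apply: continuous_measurable_fun; exact: sqrt_continuous.
apply: measurable_sum => i; apply: measurable_funX.
by apply: measurable_funB; apply: (measurableT_comp (measurable_tnth i)).
Qed.

Lemma measurable_bandwidth d (T : measurableType d) (R : realType) (n p : nat)
    (x : 'I_n -> T -> p.-tuple R) :
  (forall s, measurable_fun setT (x s)) ->
  measurable_fun setT (fun w => bandwidth (fun s => x s w)).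
Proof. by move=> mx; apply: measurable_median => i; exact: measurable_edist. Qed.

Lemma measurable_uprod d (T : measurableType d) (R : realType) (n : nat)
    (A B : T -> 'M[R]_n) :
  (forall s t, measurable_fun setT (fun w => A w s t)) ->
  (forall s t, measurable_fun setT (fun w => B w s t)) ->
  measurable_fun setT (fun w => uprod (A w) (B w)).
Proof.
have mu (C : T -> 'M[R]_n) s t :
    (forall s t, measurable_fun setT (fun w => C w s t)) ->
    measurable_fun setT (fun w => ucenter (C w) s t).
  move=> mC; under eq_fun do rewrite mxE.
  case: (s == t); first exact: measurable_cst.
  apply: measurable_funD; first apply: measurable_funB; first apply: measurable_funB => //.
  - by apply: measurable_funM => //; exact: measurable_sum.
  - by apply: measurable_funM => //; exact: measurable_sum.
  - apply: measurable_funM => //; apply: measurable_sum => u.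
    exact: measurable_sum.
move=> mA mB; apply: measurable_funM => //; apply: measurable_sum => s.
under eq_fun do rewrite big_mkcond.
apply: measurable_sum => t; case: (s != t); last exact: measurable_cst.
by apply: measurable_funM; exact: mu.
Qed.

(** * Independent copies and conditional expectations *)

(* [mu] is the common law of [U] and [V]. *)
Definition iid_pair d d' (T : measurableType d) (E : measurableType d')
    (R : realType) (P : probability T R) (mu : probability E R)
    (U V : T -> E) : Prop :=
  forall A B : set E, measurable A -> measurable B ->
    P ((U @^-1` A) `&` (V @^-1` B)) = (mu A * mu B)%E.

(** The family consists of joint vectors (X, Y); the map [phi] extracts one component. Independence
    is used for the two-element index set containing [s] and [t]. *)
Lemma mutually_independent_iid_pair d d' d'' (T : measurableType d)
    (E : measurableType d') (E' : measurableType d'') (R : realType)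
    (P : probability T R) (I : finType) (W : I -> T -> E) (Z : T -> E)
    (phi : E -> E') (U : {RV P >-> E'}) (s t : I) :
  mutually_independent P W -> s != t ->
  (forall i, same_law P (W i) Z) -> measurable_fun setT phi ->
  phi \o Z = U ->
  iid_pair P (distribution P U) (phi \o W s) (phi \o W t).
Proof.
move=> ind st law mphi ZU A B mA mB.
have mphiV C : measurable C -> measurable (phi @^-1` C).
  by move=> mC; rewrite -[X in measurable X]setTI; exact: mphi.
pose C i := if i == s then phi @^-1` A else phi @^-1` B.
have mC i : measurable (C i) by rewrite /C; case: ifP => _; exact: mphiV.
have := ind [set s; t]%SET C mC.
rewrite big_setU1 ?inE//= big_set1 !law// /C eqxx eq_sym (negbTE st).
rewrite /distribution /pushforward -ZU => h; apply: etrans h.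
congr (P _); apply/seteqP; split => w /=.
  move=> [h1 h2] i; rewrite !inE => /orP[]/eqP->; rewrite ?eqxx//.
  by rewrite eq_sym (negbTE st).
move=> h; split; first by have := h s; rewrite !inE eqxx => /(_ isT).
by have := h t; rewrite !inE eqxx orbT eq_sym (negbTE st) => /(_ isT).
Qed.

Section iid_pair_theory.
Context d d' (T : measurableType d) (E : measurableType d') (R : realType).
Variables (P : probability T R) (mu : probability E R) (U V : {RV P >-> E}).
Hypothesis UV : iid_pair P mu U V.

Let pairUV (w : T) : E * E := (U w, V w).

Let mpairUV : measurable_fun setT pairUV.
Proof. exact: measurable_fun_pair. Qed.

HB.instance Definition _ := isMeasurableFun.Build _ _ _ _ pairUV mpairUV.

Lemma iid_pair_sym : iid_pair P mu V U.
Proof. by move=> A B mA mB; rewrite setIC UV// muleC. Qed.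

(** Rectangles determine a measure on the product, so the product rule on them identifies the joint
    law. In particular any two such pairs with the same [mu] are equidistributed. *)
Lemma iid_pair_law (C : set (E * E)) : measurable C ->
  P [set w | C (U w, V w)] = (mu \x mu)%E C.
Proof.
move=> mC; apply/esym.
have := @product_measure_unique _ _ _ _ R mu mu (distribution P pairUV).
by apply => // A B mA mB; rewrite -UV.
Qed.

Lemma iid_pair_ge0_integral (f : E * E -> \bar R) :
  measurable_fun setT f -> (forall z, 0 <= f z)%E ->
  (\int[P]_w f (U w, V w) = \int[mu]_x \int[mu]_y f (x, y))%E.
Proof.
move=> mf f0; rewrite -(@fubini_tonelli1 _ _ _ _ _ mu mu _ mf f0).
rewrite -[LHS](@ge0_integral_distribution _ _ _ _ _ P pairUV)//.
by apply: eq_measure_integral => A mA _; exact: iid_pair_law.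
Qed.

Lemma iid_pair_integrable (f : E * E -> \bar R) :
  measurable_fun setT f -> P.-integrable setT (fun w => f (U w, V w)) ->
  (mu \x mu)%E.-integrable setT f.
Proof.
move=> mf; move=> /integrableP[_ fi]; apply/integrableP; split => //.
apply: le_lt_trans fi; rewrite fubini_tonelli1//=; last exact: measurableT_comp.
by rewrite -iid_pair_ge0_integral//; exact: measurableT_comp.
Qed.

Lemma iid_pair_integral (f : E * E -> \bar R) (B : set E) :
  measurable B -> measurable_fun setT f ->
  P.-integrable setT (fun w => f (U w, V w)) ->
  (\int[P]_(w in U @^-1` B) f (U w, V w) = \int[mu]_(x in B) \int[mu]_y f (x, y))%E.
Proof.
move=> mB mf fi; have mfi := iid_pair_integrable mf fi.
have mBT : measurable (B `*` [set: E]) by exact: measurableX.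
have -> : (\int[P]_(w in U @^-1` B) f (U w, V w))%E
   = (\int[(mu \x mu)%E]_(z in B `*` setT) f z)%E.
  rewrite (_ : U @^-1` B = pairUV @^-1` (B `*` setT)); last first.
    by apply/seteqP; split => w /=; [|case].
  rewrite -[LHS](@integral_pushforward _ _ _ _ R pairUV mpairUV P)//; last first.
    apply: integrableS fi => //; rewrite -[X in measurable X]setTI.
    exact: mpairUV.
  by apply: eq_measure_integral => A mA _; exact: iid_pair_law.
rewrite integral_mkcond -integral12_prod_meas1; last first.
  by apply/integrable_restrict => //; rewrite setTI; exact: integrableS mfi.
rewrite [RHS]integral_mkcond; apply: eq_integral => x _ /=.
rewrite /fubini_F !patchE; case: ifPn => xB.
  by apply: eq_integral => y _; rewrite patchE mem_set//; split => //; exact: set_mem.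
rewrite integral0_eq// => y _; rewrite patchE memNset// => -[/= Bx _].
by move: xB; rewrite mem_set.
Qed.

End iid_pair_theory.

(** Both versions factor through [Z], so the comparison moves to the law of [Z] on the line, where
    two integrable functions with equal integrals over all Borel sets agree almost everywhere. *)
Lemma is_cexp_ae_unique d (T : measurableType d) (R : realType)
    (P : probability T R) (Z : {RV P >-> R}) (W V V' : T -> R) :
  is_cexp P Z W V -> is_cexp P Z W V' -> {ae P, forall w, V w = V' w}.
Proof.
move=> [[m mm ->] iV eV] [[m' mm' ->] iV' eV'].
have mmE : measurable_fun setT (EFin \o m) by exact/measurable_EFinP.
have mmE' : measurable_fun setT (EFin \o m') by exact/measurable_EFinP.
have int_m : (distribution P Z).-integrable setT (EFin \o m).
  exact: integrable_pushforward.
have int_m' : (distribution P Z).-integrable setT (EFin \o m').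
  exact: integrable_pushforward.
have [N [mN N0 sN]] : ae_eq (distribution P Z) setT (EFin \o m) (EFin \o m').
  apply: integral_ae_eq => // B _ mB.
  have mZB : measurable (Z @^-1` B) by exact: measurable_funPTI.
  rewrite /distribution !integral_pushforward//; first by rewrite eV// eV'.
  - exact: integrableS iV'.
  - exact: integrableS iV.
exists (Z @^-1` N); split => //; first exact: measurable_funPTI.
by move=> w /= h; apply: sN => /= h'; apply: h; have [] := h' I.
Qed.

Lemma cexp_ae d (T : measurableType d) (R : realType) (P : probability T R)
    (Z : {RV P >-> R}) (W V : T -> R) :
  is_cexp P Z W V -> {ae P, forall w, cexp P Z W w = V w}.
Proof.
move=> h; apply: (is_cexp_ae_unique _ h).
exact: (@xgetPex _ (cst 0) [set V | is_cexp P Z W V] (ex_intro _ V h)).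
Qed.

Lemma measurable_cexp d (T : measurableType d) (R : realType)
    (P : probability T R) (Z : {RV P >-> R}) (W : T -> R) :
  measurable_fun setT (cexp P Z W).
Proof.
rewrite /cexp; case: xgetP => [V _ [[m mm ->] _ _]|_]; last exact: measurable_cst.
exact: measurableT_comp.
Qed.

(** By Fubini, conditioning on [U] integrates out [V] under its law. The inner integral may be
    infinite or undefined on a null set of [x]; [fine] makes the version real-valued there. *)
Lemma is_cexp_iid_pair d (T : measurableType d) (R : realType)
    (P : probability T R) (mu : probability R R) (U V : {RV P >-> R})
    (k : R -> R -> R) :
  iid_pair P mu U V -> measurable_fun setT (fun z : R * R => k z.1 z.2) ->
  P.-integrable setT (fun w => (k (U w) (V w))%:E) ->
  is_cexp P U (fun w => k (U w) (V w))
    ((fun x => fine (\int[mu]_y (k x y)%:E)%E) \o U).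
Proof.
move=> UV mk ik; pose f (z : R * R) := (k z.1 z.2)%:E.
have mf : measurable_fun setT f by exact/measurable_EFinP.
have if_ : (mu \x mu)%E.-integrable setT f by exact: (iid_pair_integrable UV).
pose F x := (\int[mu]_y f (x, y))%E.
have mF : measurable_fun setT F by exact: (measurable_fubini_F if_).
have iF : mu.-integrable setT F by exact: (integrable_fubini_F if_).
have mFf : measurable_fun setT (fine \o F) by exact: measurableT_comp.
have mFfE : measurable_fun setT (fun x => (fine (F x))%:E).
  exact/measurable_EFinP.
have iFf : mu.-integrable setT (fun x => (fine (F x))%:E).
  apply: le_integrable iF => // x _.
  by case: (F x) => [r||] /=; rewrite ?normr0 ?leey ?lexx.
have cst1 (g : R -> \bar R) x : (\int[mu]_y g x = g x)%E.
  have mu1 : (mu [set: R] = 1)%E by exact: probability_setT.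
  by rewrite integral_cst// -[RHS]mule1 -mu1.
have iFfU : P.-integrable setT (fun w => (fine (F (U w)))%:E).
  apply/integrableP; split.
    by apply/measurable_EFinP; exact: (measurableT_comp mFf).
  pose g (z : R * R) := `|(fine (F z.1))%:E|%E.
  have mg : measurable_fun setT g.
    apply: measurableT_comp => //; apply/measurable_EFinP.
    exact: (measurableT_comp mFf).
  have g0 z : (0 <= g z)%E by rewrite /g.
  rewrite (iid_pair_ge0_integral UV mg g0).
  under eq_integral do rewrite (cst1 (fun x => `|(fine (F x))%:E|%E)).
  by have /integrableP[] := iFf.
split; [by exists (fine \o F) | exact: iFfU |] => B mB.
pose g (z : R * R) := (fine (F z.1))%:E.
have mg : measurable_fun setT g.
  by apply/measurable_EFinP; exact: (measurableT_comp mFf).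
rewrite (iid_pair_integral UV mB mf)// (iid_pair_integral UV mB mg)//.
under eq_integral do rewrite (cst1 (fun x => (fine (F x))%:E)).
(* The inner integral is finite for almost every [x], so inserting [fine] does not change the outer
   one. *)
apply: ae_eq_integral => //; try exact: measurable_funTS.
have := integrable_ae measurableT iF; apply: filterS => x /= Fx _.
by rewrite fineK// Fx.
Qed.

Lemma cexp0_ae d (T : measurableType d) (R : realType) (P : probability T R)
    (Z : {RV P >-> R}) : {ae P, forall w, cexp P Z (cst 0) w = 0}.
Proof.
apply: (@cexp_ae _ _ _ _ _ _ (cst 0)); split => //; last exact: integrable0.
by exists (cst 0).
Qed.

Lemma dcenter_diag_ae d (T : measurableType d) (R : realType)
    (P : probability T R) (k : R -> R -> R) (U : {RV P >-> R}) :
  (forall x, k x x = 0) -> {ae P, forall w, dcenter P k U U w = 0}.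
Proof.
move=> k0; have kU : (fun w => k (U w) (U w)) = cst 0 by apply/funext => w /=.
have := cexp0_ae U; apply: filterS => w cw.
by rewrite /dcenter kU cw expectation_cst !subr0 addr0.
Qed.

Lemma dcenter_iid_pair_ae d (T : measurableType d) (R : realType)
    (P : probability T R) (mu : probability R R) (k : R -> R -> R)
    (U V : {RV P >-> R}) :
  let m x := fine (\int[mu]_y (k x y)%:E)%E in
  iid_pair P mu U V -> (forall x y, k x y = k y x) ->
  measurable_fun setT (fun z : R * R => k z.1 z.2) ->
  P.-integrable setT (fun w => (k (U w) (V w))%:E) ->
  {ae P, forall w, dcenter P k U V w = k (U w) (V w) - m (U w) - m (V w)
    + fine (\int[mu]_x \int[mu]_y (k x y)%:E)%E}.
Proof.
move=> m UV ksym mk ik.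
have ik' : P.-integrable setT (fun w => (k (V w) (U w))%:E).
  by under eq_fun do rewrite ksym.
have := cexp_ae (is_cexp_iid_pair UV mk ik).
have := cexp_ae (is_cexp_iid_pair (iid_pair_sym UV) mk ik').
apply: filterS2 => w hV hU; rewrite /dcenter hU.
rewrite (_ : (fun w => k (U w) (V w)) = fun w => k (V w) (U w)); last first.
  by apply/funext => w'; exact: ksym.
rewrite hV /=; congr (_ + fine _).
pose f (z : R * R) := (k z.1 z.2)%:E.
have mf : measurable_fun setT f by exact/measurable_EFinP.
rewrite unlock; have := iid_pair_integral UV measurableT mf ik.
by rewrite preimage_setT => <-; apply: eq_integral => w' _; rewrite /= ksym.
Qed.

(** Identical laws give the same regression function [m] for every index, so off the diagonal the
    double centering only adds an additive matrix; on the diagonal the vanishing of [k] makes both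
    matrices zero. Finitely many index pairs share one null set. *)
Lemma ucenter_dcenter_ae d (T : measurableType d) (R : realType)
    (P : probability T R) (mu : probability R R) (k : R -> R -> R) (n : nat)
    (u : 'I_n -> T -> R) :
  (3 <= n)%N -> (forall s, measurable_fun setT (u s)) ->
  (forall s t, s != t -> iid_pair P mu (u s) (u t)) ->
  (forall x, k x x = 0) -> (forall x y, k x y = k y x) ->
  measurable_fun setT (fun z : R * R => k z.1 z.2) ->
  (forall s t, s != t -> P.-integrable setT (fun w => (k (u s w) (u t w))%:E)) ->
  {ae P, forall w, ucenter (\matrix_(s, t) dcenter P k (u s) (u t) w)
                 = ucenter (\matrix_(s, t) k (u s w) (u t w))}.
Proof.
move=> n3 mu_ iid k0 ksym mk ik.
pose U s : {RV P >-> R} := HB.pack (u s) (isMeasurableFun.Build _ _ _ _ (u s) (mu_ s)).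
pose m x := fine (\int[mu]_y (k x y)%:E)%E.
pose c := fine (\int[mu]_x \int[mu]_y (k x y)%:E)%E.
have H s t : {ae P, forall w, dcenter P k (u s) (u t) w =
    if s == t then 0 else k (u s w) (u t w) - m (u s w) - m (u t w) + c}.
  case: (eqVneq s t) => [->|st]; first exact: (dcenter_diag_ae (U t)).
  exact: (@dcenter_iid_pair_ae _ _ _ _ mu k (U s) (U t) (iid s t st)
    ksym mk (ik s t st)).
have : {ae P, forall w, forall s t, dcenter P k (u s) (u t) w =
    if s == t then 0 else k (u s w) (u t w) - m (u s w) - m (u t w) + c}.
  by apply: filter_forall => s; apply: filter_forall => t; exact: H.
apply: filterS => w Hw.
(* The constant [c] is split evenly between row and column to fit the additive form. *)
rewrite (_ : \matrix_(s, t) dcenter _ _ _ _ _ =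
  \matrix_(s, t) k (u s w) (u t w)
  + hollow (fun s t => (c / 2 - m (u s w)) + (c / 2 - m (u t w)))).
  by rewrite linearD /= ucenter_hollowD ?addr0.
apply/matrixP => s t; rewrite !mxE Hw; case: eqP => [->|_]; first by rewrite k0 addr0.
by rewrite [in LHS](splitr c); ring.
Qed.

Lemma uCov2_ae d (T : measurableType d) (R : realType) (P : probability T R)
    (k : R -> R -> R) (n p q : nat)
    (mu : 'I_p -> probability R R) (nu : 'I_q -> probability R R)
    (x : 'I_n -> T -> p.-tuple R) (y : 'I_n -> T -> q.-tuple R) :
  let xi i s w := tnth (x s w) i in let yj j s w := tnth (y s w) j in
  (3 <= n)%N ->
  (forall i s, measurable_fun setT (xi i s)) ->
  (forall j s, measurable_fun setT (yj j s)) ->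
  (forall i s t, s != t -> iid_pair P (mu i) (xi i s) (xi i t)) ->
  (forall j s t, s != t -> iid_pair P (nu j) (yj j s) (yj j t)) ->
  (forall z, k z z = 0) -> (forall z z', k z z' = k z' z) ->
  measurable_fun setT (fun z : R * R => k z.1 z.2) ->
  (forall i s t, s != t ->
     P.-integrable setT (fun w => (k (xi i s w) (xi i t w))%:E)) ->
  (forall j s t, s != t ->
     P.-integrable setT (fun w => (k (yj j s w) (yj j t w))%:E)) ->
  {ae P, forall w, uCov2 P k k x y w = (Num.sqrt (p%:R * q%:R))^-1 *
    \sum_(i < p) \sum_(j < q)
      uprod (\matrix_(s, t) k (tnth (x s w) i) (tnth (x t w) i))
            (\matrix_(s, t) k (tnth (y s w) j) (tnth (y t w) j))}.
Proof.
move=> xi yj n3 mxi myj iidx iidy k0 ksym mk ikx iky.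
have Hx : {ae P, forall w, forall i,
    ucenter (\matrix_(s, t) dcenter P k (xi i s) (xi i t) w)
    = ucenter (\matrix_(s, t) k (xi i s w) (xi i t w))}.
  apply: filter_forall => i.
  exact: (ucenter_dcenter_ae n3 (mxi i) (iidx i) k0 ksym mk (ikx i)).
have Hy : {ae P, forall w, forall j,
    ucenter (\matrix_(s, t) dcenter P k (yj j s) (yj j t) w)
    = ucenter (\matrix_(s, t) k (yj j s w) (yj j t w))}.
  apply: filter_forall => j.
  exact: (ucenter_dcenter_ae n3 (myj j) (iidy j) k0 ksym mk (iky j)).
apply: filterS2 Hx Hy => w hx hy; congr (_ * _).
apply: eq_bigr => i _; apply: eq_bigr => j _.
exact: (uprod_ucenter (hx i) (hy j)).
Qed.

Lemma measurable_uCov2 d (T : measurableType d) (R : realType)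
    (P : probability T R) (k : R -> R -> R) (n p q : nat)
    (x : 'I_n -> T -> p.-tuple R) (y : 'I_n -> T -> q.-tuple R) :
  (forall s, measurable_fun setT (x s)) ->
  (forall s, measurable_fun setT (y s)) ->
  measurable_fun setT (fun z : R * R => k z.1 z.2) ->
  measurable_fun setT (uCov2 P k k x y).
Proof.
move=> mx my mk.
have md (U V : {RV P >-> R}) : measurable_fun setT (dcenter P k U V).
  apply: measurable_funD => //; apply: measurable_funB.
    apply: measurable_funB; last exact: measurable_cexp.
    have mUV : measurable_fun setT (fun w => (U w, V w)).
      exact: measurable_fun_pair.
    exact: (measurableT_comp mk mUV).
  exact: measurable_cexp.
have mt r (z : 'I_n -> T -> r.-tuple R) s i :
    (forall s, measurable_fun setT (z s)) ->
    measurable_fun setT (fun w => tnth (z s w) i).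
  by move=> mz; exact: (measurableT_comp (measurable_tnth i) (mz s)).
pose RVof r (z : 'I_n -> T -> r.-tuple R) mz s i : {RV P >-> R} :=
  HB.pack (fun w => tnth (z s w) i)
    (isMeasurableFun.Build _ _ _ _ (fun w => tnth (z s w) i) (mt r z s i mz)).
apply: measurable_funM => //; apply: measurable_sum => i.
apply: measurable_sum => j; apply: measurable_uprod => s t.
  under eq_fun do rewrite mxE.
  exact: (md (RVof p x mx s i) (RVof p x mx t i)).
under eq_fun do rewrite mxE.
exact: (md (RVof q y my s j) (RVof q y my t j)).
Qed.

Lemma iid_pair_comp d d' d'' (T : measurableType d) (E : measurableType d')
    (E' : measurableType d'') (R : realType) (P : probability T R)
    (mu : probability E R) (nu : probability E' R) (U V : T -> E)
    (phi : E -> E') :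
  iid_pair P mu U V -> measurable_fun setT phi ->
  (forall A, measurable A -> nu A = mu (phi @^-1` A)) ->
  iid_pair P nu (phi \o U) (phi \o V).
Proof.
move=> UV mphi nuE A B mA mB; rewrite !nuE// -UV//.
  by rewrite -[X in measurable X]setTI; exact: mphi.
by rewrite -[X in measurable X]setTI; exact: mphi.
Qed.

(** * Second moments of differences of independent copies *)

Section second_moment.
Context d (T : measurableType d) (R : realType) (P : probability T R).

Lemma sqr_int_Lfun2 (U : {RV P >-> R}) :
  ('E_P[fun w => (U w ^+ 2)%R] < +oo)%E -> (U : T -> R) \in Lfun P 2%:E.
Proof.
move=> h; rewrite inE; apply/andP; split.
  by rewrite inE/=; exact: measurable_funP.
rewrite inE /= /finite_norm unlock /Lnorm /=; apply: poweR_lty.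
move: h; rewrite unlock; apply: le_lt_trans; apply: ge0_le_integral => //.
- apply/measurable_EFinP.
  apply: (@measurableT_comp _ _ _ _ _ _ (fun x : R => x `^ 2)).
    exact: measurable_powR.
  exact: measurableT_comp.
- by apply/measurable_EFinP; exact: measurable_funX.
- by move=> w _; rewrite lee_fin powR_mulrn// real_normK// num_real.
Qed.

(** The variance is invariant under the shift by [c] and is at most the second moment of the shifted
    variable. *)
Lemma variance_le_sqrB (U : {RV P >-> R}) (c : R) :
  ('E_P[fun w => (U w ^+ 2)%R] < +oo)%E ->
  ('V_P[U] <= \int[P]_w ((c - U w) ^+ 2)%:E)%E.
Proof.
move=> /sqr_int_Lfun2 U2; rewrite -(varianceB_cst_r c U2).
have Uc2 : (U \- cst c)%R \in Lfun P 2%:E.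
  by rewrite rpredB ?lee1n//= => _; rewrite Lfun_cst.
rewrite varianceE//; apply: (@le_trans _ _ ('E_P[(U \- cst c) ^+ 2])%E).
  by rewrite leeBlDr ?leeDl// ?sqre_ge0// fin_numX// expectation_fin_num//
    Lfun_subset12// fin_num_measure.
rewrite (_ : (U \- cst c) ^+ 2 = fun w => (c - U w) ^+ 2); first by rewrite unlock.
by apply/funext => w; rewrite -[c - U w]opprB sqrrN.
Qed.

Variables (X U V : {RV P >-> R}).
Let mu : probability R R := distribution P X.
Hypothesis UV : iid_pair P mu U V.

Let msqB (c : R) : measurable_fun setT (fun y : R => ((c - y) ^+ 2)%:E).
Proof. by apply/measurable_EFinP; apply: measurable_funX; exact: measurable_funB. Qed.

Let msqB2 : measurable_fun setT (fun z : R * R => ((z.1 - z.2) ^+ 2)%:E).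
Proof. by apply/measurable_EFinP; apply: measurable_funX; exact: measurable_funB. Qed.

Let sqr0 (x : R) : (0%:E <= (x ^+ 2)%:E)%E.
Proof. by rewrite lee_fin sqr_ge0. Qed.

(** For each frozen value of [U], the integral over [V] is a second moment about a point, hence at
    least the variance. The exact value is twice the variance, but a positive lower bound is enough
    to keep tau away from 0. *)
Lemma iid_pair_sqrB_ge (a : R) :
  (a%:E <= 'V_P[X])%E -> ('E_P[fun w => (X w ^+ 2)%R] < +oo)%E ->
  (a%:E <= \int[P]_w ((U w - V w) ^+ 2)%:E)%E.
Proof.
move=> hV h2; rewrite (iid_pair_ge0_integral UV msqB2 (fun z => sqr0 _)).
have -> : a%:E = (\int[mu]_x a%:E)%E.
  by rewrite integral_cst// -[LHS]mule1 -(probability_setT mu).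
have [a0|a0] := leP 0 a; last first.
  apply: (@le_trans _ _ 0%E).
    by rewrite integral_cst// mule_le0_ge0// lee_fin ltW.
  by apply: integral_ge0 => x _; exact: integral_ge0.
apply: ge0_le_integral => //.
- exact: (@measurable_fun_fubini_tonelli_F _ _ _ _ _ mu _ msqB2 (fun z => sqr0 _)).
- move=> x _; rewrite (ge0_integral_distribution X (msqB x) (fun y => sqr0 _)).
  exact: le_trans hV (variance_le_sqrB _ h2).
Qed.

Lemma iid_pair_sqrB_le (b : R) :
  ('E_P[fun w => (X w ^+ 2)%R] <= b%:E)%E ->
  (\int[P]_w ((U w - V w) ^+ 2)%:E <= (4 * b)%:E)%E.
Proof.
move=> hb.
have msq (W : {RV P >-> R}) : measurable_fun setT (fun w => (W w ^+ 2)%:E).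
  by apply/measurable_EFinP; exact: measurable_funX.
have mu1 (c : \bar R) : (\int[mu]_x c = c)%E.
  by rewrite integral_cst// -[RHS]mule1 -(probability_setT mu).
have m1 : measurable_fun setT (fun z : R * R => (z.1 ^+ 2)%:E).
  by apply/measurable_EFinP; exact: measurable_funX.
have m2 : measurable_fun setT (fun z : R * R => (z.2 ^+ 2)%:E).
  by apply/measurable_EFinP; exact: measurable_funX.
have mE : measurable_fun setT (fun x : R => (x ^+ 2)%:E).
  by apply/measurable_EFinP; exact: measurable_funX.
have EX : (\int[mu]_x (x ^+ 2)%:E <= b%:E)%E.
  by rewrite (ge0_integral_distribution X mE (fun y => sqr0 _)); move: hb; rewrite unlock.
have EU : (\int[P]_w (U w ^+ 2)%:E <= b%:E)%E.
  rewrite (iid_pair_ge0_integral UV m1 (fun z => sqr0 _)) /=.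
  by under eq_integral do rewrite mu1.
have EV : (\int[P]_w (V w ^+ 2)%:E <= b%:E)%E.
  by rewrite (iid_pair_ge0_integral UV m2 (fun z => sqr0 _)) /= mu1.
(* The bound (u - v)^2 <= 2 (u^2 + v^2) yields the constant [4 * b]. *)
apply: (@le_trans _ _ (\int[P]_w (2%:E * ((U w ^+ 2)%:E + (V w ^+ 2)%:E)))%E).
  apply: ge0_le_integral => //.
  - by apply/measurable_EFinP; apply: measurable_funX; exact: measurable_funB.
  - apply: emeasurable_funM => //; exact: emeasurable_funD.
  - move=> w _; rewrite -EFinD -EFinM lee_fin.
    by have := sqr_ge0 (U w + V w); nra.
rewrite ge0_integralZl//; [|exact: emeasurable_funD|by move=> w _; rewrite adde_ge0].
rewrite ge0_integralD//.
apply: (@le_trans _ _ (2%:E * (b%:E + b%:E))%E); first by rewrite lee_pmul2l// leeD.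
by rewrite -EFinD -EFinM lee_fin; lra.
Qed.

Lemma iid_pair_sqrB_integrable (b : R) :
  ('E_P[fun w => (X w ^+ 2)%R] <= b%:E)%E ->
  P.-integrable setT (fun w => ((U w - V w) ^+ 2)%:E).
Proof.
move=> hb; apply/integrableP; split.
  by apply/measurable_EFinP; apply: measurable_funX; exact: measurable_funB.
under eq_integral do rewrite gee0_abs ?sqr0//.
exact: le_lt_trans (iid_pair_sqrB_le hb) (ltry _).
Qed.

Lemma iid_pair_normB_integrable (b : R) :
  ('E_P[fun w => (X w ^+ 2)%R] <= b%:E)%E ->
  P.-integrable setT (fun w => `|U w - V w|%:E).
Proof.
move=> hb.
(* The dominating function comes from |z| <= 1 + z^2. *)
have h : P.-integrable setT (fun w => (1 + (U w - V w) ^+ 2)%:E).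
  under eq_fun do rewrite EFinD.
  apply: integrableD => //; last exact: iid_pair_sqrB_integrable hb.
  exact: finite_measure_integrable_cst.
apply: le_integrable h => //.
  apply/measurable_EFinP; apply: measurableT_comp => //; exact: measurable_funB.
move=> w _ /=; rewrite lee_fin normr_id [leRHS]ger0_norm ?addr_ge0 ?sqr_ge0//.
rewrite -(real_normK (num_real (U w - V w))); 
move: `|U w - V w| (normr_ge0 (U w - V w)) => z z0; have := sqr_ge0 (z - 1). nra.
Qed.

End second_moment.

(** * Deterministic expansions *)

(* The paper's [L_X(X_s, X_t)] when [t2 = tau_X ^+ 2]. *)
Definition relsq (R : realType) (n p : nat) (t2 : R) (x : 'I_n -> p.-tuple R) :
    'M[R]_n :=
  hollow (fun s t => (Defs.edist (x s) (x t) ^+ 2 - t2) / t2).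

Section deterministic.
Context (R : realType) (n : nat).

Let J : 'M[R]_n := hollow (fun _ _ => 1).

Lemma edist_ge0 (p : nat) (x y : p.-tuple R) : 0 <= Defs.edist x y.
Proof. exact: sqrtr_ge0. Qed.

Lemma edistxx (p : nat) (x : p.-tuple R) : Defs.edist x x = 0.
Proof.
by rewrite /Defs.edist big1 ?sqrtr0// => i _; rewrite subrr expr0n.
Qed.

Lemma sqr_edist (p : nat) (x y : p.-tuple R) :
  Defs.edist x y ^+ 2 = \sum_(i < p) (tnth x i - tnth y i) ^+ 2.
Proof. by rewrite sqr_sqrtr// sumr_ge0// => i _; rewrite sqr_ge0. Qed.

Lemma relsq_edist (p : nat) (x : 'I_n -> p.-tuple R) (t2 : R) (s t : 'I_n) :
  t2 != 0 -> s != t ->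
  Defs.edist (x s) (x t) ^+ 2 = t2 * (1 + relsq t2 x s t).
Proof. by move=> t20 st; rewrite mxE (negbTE st); field. Qed.

Lemma ucenter_sqr_edist (p : nat) (x : 'I_n -> p.-tuple R) (t2 : R) :
  (3 <= n)%N -> t2 != 0 ->
  ucenter (\matrix_(s, t) (Defs.edist (x s) (x t) ^+ 2))
  = ucenter (t2 *: relsq t2 x).
Proof.
move=> n3 t20.
rewrite (_ : \matrix_(s, t) _ = hollow (fun=> fun=> t2 / 2 + t2 / 2) + t2 *: relsq t2 x).
  by rewrite linearD /= (ucenter_hollowD (fun=> t2 / 2))// add0r.
apply/matrixP => s t; rewrite !mxE; case: eqP => [->|_].
  by rewrite edistxx expr0n mulr0 addr0.
by rewrite -splitr; field.
Qed.

(** Bilinearity moves the sums inside, where squared coordinate differences add up to the squared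
    Euclidean distance; this additivity is special to the squared kernel. *)
Lemma sum_uprod_sqr (p q : nat) (x : 'I_n -> p.-tuple R) (y : 'I_n -> q.-tuple R)
    (t2 u2 : R) :
  (3 <= n)%N -> t2 != 0 -> u2 != 0 ->
  \sum_(i < p) \sum_(j < q)
    uprod (\matrix_(s, t) (`|tnth (x s) i - tnth (x t) i| ^+ 2))
          (\matrix_(s, t) (`|tnth (y s) j - tnth (y t) j| ^+ 2))
  = t2 * u2 * uprod (relsq t2 x) (relsq u2 y).
Proof.
move=> n3 t20 u20.
have E r (z : 'I_n -> r.-tuple R) :
    \sum_(i < r) \matrix_(s, t) (`|tnth (z s) i - tnth (z t) i| ^+ 2)
    = \matrix_(s, t) (Defs.edist (z s) (z t) ^+ 2).
  apply/matrixP => s t; rewrite summxE !mxE sqr_edist; apply: eq_bigr => i _.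
  by rewrite mxE real_normK// num_real.
under eq_bigr do rewrite -uprod_sumr E.
rewrite -uprod_suml E.
rewrite (uprod_ucenter (ucenter_sqr_edist x n3 t20) (ucenter_sqr_edist y n3 u20)).
by rewrite uprodZl uprodZr mulrA.
Qed.

(** With r = sqrt (1 + l) the error is exactly (r - 1)^2 / 2, while l^2 = (r + 1)^2 (r - 1)^2 and r
    + 1 >= 1; hence no smallness of [l] is required. *)
Lemma sqrt_taylor1 (l : R) : -1 <= l -> `|Num.sqrt (1 + l) - 1 - 2^-1 * l| <= l ^+ 2.
Proof.
move=> l1; have : 0 <= 1 + l by lra.
move=> /sqr_sqrtr; have := sqrtr_ge0 (1 + l); move: (Num.sqrt _) => r r0 rE.
have -> : l = r ^+ 2 - 1 by rewrite rE; ring.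
rewrite (_ : _ - _ = - (2^-1 * (r - 1) ^+ 2)); last by field.
rewrite normrN ger0_norm; last by rewrite pmulr_rge0 ?invr_gt0// sqr_ge0.
rewrite (_ : (r ^+ 2 - 1) ^+ 2 = (r + 1) ^+ 2 * (r - 1) ^+ 2); last by ring.
rewrite ler_wpM2r ?sqr_ge0//; nra.
Qed.

Definition edist_rem (p : nat) (t2 : R) (x : 'I_n -> p.-tuple R) : 'M[R]_n :=
  (Num.sqrt t2)^-1 *: (\matrix_(s, t) Defs.edist (x s) (x t))
  - J - 2^-1 *: relsq t2 x.

Lemma edist_rem_le (p : nat) (t2 : R) (x : 'I_n -> p.-tuple R) (e : R) :
  0 < t2 -> (forall s t, `|relsq t2 x s t| <= e) ->
  forall s t, `|edist_rem t2 x s t| <= e ^+ 2.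
Proof.
move=> t20 hx s t; have e0 : 0 <= e by rewrite (le_trans _ (hx s t)).
have [<-|st] := eqVneq s t.
  rewrite !mxE eqxx edistxx !mulr0 !subr0 normr0; exact: sqr_ge0.
have hl := relsq_edist x (lt0r_neq0 t20) st.
have hle := hx s t.
set l := relsq t2 x s t in hl hle *.
(* Automatic, because [t2 * (1 + l)] is a squared distance. *)
have l1 : -1 <= l.
  have : 0 <= t2 * (1 + l) by rewrite -hl sqr_ge0.
  by rewrite pmulr_rge0// => ?; lra.
have -> : edist_rem t2 x s t = Num.sqrt (1 + l) - 1 - 2^-1 * l.
  rewrite !mxE (negbTE st) -/l; congr (_ - _ - 2^-1 * _).
    rewrite -[Defs.edist _ _]ger0_norm ?edist_ge0// -sqrtr_sqr hl sqrtrM 1?ltW//.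
    by rewrite mulKf// sqrtr_eq0 -ltNge.
  by rewrite /l mxE (negbTE st).
apply: le_trans (sqrt_taylor1 l1) _.
by rewrite -[l ^+ 2]real_normK ?num_real// lerXn2r// nnegrE.
Qed.

Lemma dCov2_expansion (p q : nat) (x : 'I_n -> p.-tuple R) (y : 'I_n -> q.-tuple R)
    (t2 u2 e e' : R) :
  (4 <= n)%N -> 0 < t2 -> 0 < u2 -> 0 <= e <= 1 -> 0 <= e' <= 1 ->
  (forall s t, `|relsq t2 x s t| <= e) -> (forall s t, `|relsq u2 y s t| <= e') ->
  `|dCov2 x y - 4^-1 * (Num.sqrt t2 * Num.sqrt u2)
      * uprod (relsq t2 x) (relsq u2 y)|
  <= Num.sqrt t2 * Num.sqrt u2
     * (uprod_cst R n * 2 * (e ^+ 2 * e' + e * e' ^+ 2)).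
Proof.
move=> n4 t20 u20 he he' hx hy.
have decomp r (z : 'I_n -> r.-tuple R) v2 : 0 < v2 ->
    \matrix_(s, t) Defs.edist (z s) (z t)
    = Num.sqrt v2 *: (1 *: J + (2^-1 *: relsq v2 z + edist_rem v2 z)).
  move=> v20; have sv0 : Num.sqrt v2 != 0 by rewrite sqrtr_eq0 -ltNge.
  apply/matrixP => s t; rewrite !mxE.
  case: eqP => [->|_]; first by rewrite edistxx; ring.
  by field; rewrite sv0 (lt0r_neq0 v20).
rewrite /dCov2 (decomp p x t2 t20) (decomp q y u2 u20) uprodZl uprodZr.
rewrite [X in `|X|](_ : _ = Num.sqrt t2 * Num.sqrt u2 *
  (uprod (1 *: J + (2^-1 *: relsq t2 x + edist_rem t2 x))
    (1 *: J + (2^-1 *: relsq u2 y + edist_rem u2 y))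
   - 2^-1 * 2^-1 * uprod (relsq t2 x) (relsq u2 y))); last by field.
rewrite normrM ger0_norm ?mulr_ge0 ?sqrtr_ge0// ler_wpM2l ?mulr_ge0 ?sqrtr_ge0//.
have half1 : `|2^-1 : R| <= 1 by rewrite ger0_norm//; lra.
have := @uprod_expansion R n 1 1 2^-1 2^-1 _ _ _ _ e e' 1 n4 he he' ler01 hx hy.
rewrite expr1n mulr1; apply => // s t; rewrite mul1r; exact: edist_rem_le.
Qed.
End deterministic.

(** * Expansion of kernel matrices with a random bandwidth *)

Lemma bandwidth_itv (R : realType) (n p : nat) (x : 'I_n -> p.-tuple R) (lo hi : R) :
  (2 <= n)%N -> (forall s t, s != t -> lo <= Defs.edist (x s) (x t) <= hi) ->
  lo <= bandwidth x <= hi.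
Proof.
move=> n2 h; apply: median_itv.
  rewrite size_map -cardE; apply/card_gt0P.
  by exists (Ordinal (ltnW n2), Ordinal n2); rewrite inE.
by move=> z /mapP[[s t]]; rewrite mem_enum inE /= => st ->; exact: h.
Qed.

(** The threshold 1/3 is 2/3 * 1/2: the expansion point [v] is at least 2/3, and 1 + L is at least
    1/2. *)
Definition sqrt_taylor_bound (R : realType) (f : R -> R) (K : R) : Prop :=
  forall s t, 3^-1 <= s -> 3^-1 <= t ->
    `|f (Num.sqrt t) - f (Num.sqrt s)
       - (f^`())%classic (Num.sqrt s) / (2 * Num.sqrt s) * (t - s)|
      <= K * (t - s) ^+ 2 /\
    `|(f^`())%classic (Num.sqrt s) / (2 * Num.sqrt s)| <= K.

Section kernel_expansion.
Context (R : realType) (n p : nat) (f : R -> R) (K : R).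
Variables (x : 'I_n -> p.-tuple R) (t2 e : R).
Hypotheses (n2 : (2 <= n)%N) (t20 : 0 < t2) (he : 0 <= e <= 2^-1).
Hypothesis hx : forall s t, `|relsq t2 x s t| <= e.
Hypothesis hK : sqrt_taylor_bound f K.

Let J : 'M[R]_n := hollow (fun _ _ => 1).
Let ga := bandwidth x.
Let v := t2 / ga ^+ 2.

(** With |L| <= 1/2 every squared distance lies between [t2 / 2] and [3 / 2 * t2], and a median
    stays within the range of its data. *)
Lemma bandwidth_relsq : 0 < ga /\ t2 / 2 <= ga ^+ 2 <= 3 / 2 * t2.
Proof.
have /andP[b1 b2] : Num.sqrt (t2 / 2) <= ga <= Num.sqrt (3 / 2 * t2).
  apply: bandwidth_itv => // s t st.
  have E := relsq_edist x (lt0r_neq0 t20) st; have := hx s t.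
  rewrite ler_norml => /andP[l1 l2]; move/andP: he => [e0 e1].
  rewrite -[Defs.edist _ _]ger0_norm ?edist_ge0// -sqrtr_sqr E.
  by rewrite !ler_wsqrtr//; nra.
have s0 : 0 < Num.sqrt (t2 / 2) by rewrite sqrtr_gt0 divr_gt0.
have g0 : 0 < ga by exact: lt_le_trans b1.
split => //; apply/andP; split.
  have h0 : 0 <= t2 / 2 by rewrite ltW// divr_gt0.
  by rewrite -[leLHS]sqr_sqrtr// lerXn2r// nnegrE ?sqrtr_ge0// ltW.
have h0 : 0 <= 3 / 2 * t2 by rewrite mulr_ge0// ltW.
by rewrite -[leRHS]sqr_sqrtr// lerXn2r// nnegrE ?sqrtr_ge0// ltW.
Qed.

Lemma sqrt_v : Num.sqrt v = Num.sqrt t2 / ga.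
Proof.
have [g0 _] := bandwidth_relsq.
by rewrite /v sqrtrM 1?ltW// sqrtrV ?sqr_ge0// sqrtr_sqr gtr0_norm.
Qed.

Lemma v_itv : 2 / 3 <= v <= 2.
Proof.
have [g0 /andP[g1 g2]] := bandwidth_relsq; have g20 : 0 < ga ^+ 2 by exact: exprn_gt0.
by rewrite /v ler_pdivlMr// ler_pdivrMr//; apply/andP; split; lra.
Qed.

(** Since the squared distance over [ga ^+ 2] is v (1 + L), the linear term for phi = f o sqrt is
    phi'(v) v L; [be] is phi'(v) v, as [beE] records. *)
Let be := 2^-1 * (Num.sqrt t2 / ga) * (f^`())%classic (Num.sqrt t2 / ga).

Definition kernel_rem : 'M[R]_n :=
  kernel_mx f x - f (Num.sqrt v) *: J - be *: relsq t2 x.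

Lemma kernel_mxE :
  kernel_mx f x = f (Num.sqrt v) *: J + (be *: relsq t2 x + kernel_rem).
Proof. by rewrite /kernel_rem; apply/matrixP => s t; rewrite !mxE; ring. Qed.

Let beE : be = (f^`())%classic (Num.sqrt v) / (2 * Num.sqrt v) * v.
Proof.
have /andP[v1 _] := v_itv; have v0 : 0 < v by lra.
have sv0 : Num.sqrt v != 0 by rewrite sqrtr_eq0 -ltNge.
rewrite -[X in _ = _ * X]sqr_sqrtr 1?ltW// /be -sqrt_v; field; exact: sv0.
Qed.

Lemma kernel_slope_le : `|be| <= 2 * K.
Proof.
have /andP[v1 v2] := v_itv.
have v3 : 3^-1 <= v by lra.
have [_ h] := hK v3 v3.
rewrite beE normrM mulrC ler_pM// ger0_norm//; lra.
Qed.

Lemma kernel_rem_le : forall s t, `|kernel_rem s t| <= 4 * K * e ^+ 2.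
Proof.
move=> s t; have /andP[v1 v2] := v_itv; have [g0 _] := bandwidth_relsq.
have v3 : 3^-1 <= v by lra.
have v0 : 0 < v by lra.
have K0 : 0 <= K by have [_ /(le_trans _)] := hK v3 v3; apply.
have e0 : 0 <= e by case/andP: he.
have [<-|st] := eqVneq s t.
  rewrite !mxE eqxx !mulr0 !subr0 normr0; apply: mulr_ge0; last exact: sqr_ge0.
  by rewrite mulr_ge0.
have hl := relsq_edist x (lt0r_neq0 t20) st.
have hle := hx s t; set l := relsq t2 x s t in hl hle *.
have /andP[l1 l2] : - 2^-1 <= l <= 2^-1.
  by move: hle; rewrite ler_norml => /andP[? ?]; case/andP: he => *; lra.
have u3 : 3^-1 <= v * (1 + l) by nra.
have [h _] := hK v3 u3.
have -> : kernel_rem s t = f (Num.sqrt (v * (1 + l))) - f (Num.sqrt v)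
    - (f^`())%classic (Num.sqrt v) / (2 * Num.sqrt v) * (v * (1 + l) - v).
  have lE : l = (Defs.edist (x s) (x t) ^+ 2 - t2) / t2.
    by rewrite /l mxE (negbTE st).
  rewrite !mxE (negbTE st) -lE mulr1 beE; congr (_ - _ - _); last by ring.
  congr f; have q0 : 0 <= Defs.edist (x s) (x t) / ga.
    by rewrite divr_ge0 ?edist_ge0 ?ltW.
  by rewrite -[LHS]ger0_norm// -sqrtr_sqr expr_div_n hl /v mulrAC.
apply: le_trans h _.
(* The factor 4 bounds [v ^+ 2], as [v <= 2]. *)
have -> : K * (v * (1 + l) - v) ^+ 2 = K * (v ^+ 2 * l ^+ 2) by ring.
rewrite [leRHS](_ : _ = K * (4 * e ^+ 2)); last by ring.
rewrite ler_wpM2l// ler_pM ?sqr_ge0//; first by nra.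
by rewrite -[l ^+ 2]real_normK ?num_real// lerXn2r// nnegrE.
Qed.

End kernel_expansion.

Lemma hCov2_expansion (R : realType) (n p q : nat) (f g : R -> R) (K : R)
    (x : 'I_n -> p.-tuple R) (y : 'I_n -> q.-tuple R) (t2 u2 e e' : R) :
  let bf := 2^-1 * (Num.sqrt t2 / bandwidth x)
            * (f^`())%classic (Num.sqrt t2 / bandwidth x) in
  let bg := 2^-1 * (Num.sqrt u2 / bandwidth y)
            * (g^`())%classic (Num.sqrt u2 / bandwidth y) in
  (4 <= n)%N -> 0 < t2 -> 0 < u2 -> 0 <= e <= 2^-1 -> 0 <= e' <= 2^-1 -> 0 <= K ->
  (forall s t, `|relsq t2 x s t| <= e) -> (forall s t, `|relsq u2 y s t| <= e') ->
  sqrt_taylor_bound f K -> sqrt_taylor_bound g K ->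
  `|hCov2 f g x y - bf * bg * uprod (relsq t2 x) (relsq u2 y)|
  <= uprod_cst R n * (2 * (4 * K) ^+ 2) * (e ^+ 2 * e' + e * e' ^+ 2).
Proof.
move=> bf bg n4 t20 u20 he he' K0 hx hy hf hg.
have n2 : (2 <= n)%N by exact: leq_trans n4.
rewrite /hCov2 (kernel_mxE f x t2) (kernel_mxE g y u2).
(* The constant [4 * K] covers the remainder bound and dominates the slope bound [2 * K]. *)
apply: uprod_expansion => //.
- by move: he => /andP[-> ?]; lra.
- by move: he' => /andP[-> ?]; lra.
- by rewrite mulr_ge0.
- exact: kernel_rem_le.
- exact: kernel_rem_le.
- by apply: le_trans (kernel_slope_le n2 t20 he hx hf) _; rewrite ler_wpM2r// ler_nat.
- by apply: le_trans (kernel_slope_le n2 u20 he' hy hg) _; rewrite ler_wpM2r// ler_nat.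
Qed.

(** * Random vectors and their samples *)

Section random_vectors.
Context d (T : measurableType d) (R : realType) (P : probability T R) (p : nat).
Implicit Types X U V : {RV P >-> (p.-tuple R)}.

Lemma measurable_coord U i : measurable_fun setT (fun w => tnth (U w) i).
Proof. by apply: (measurableT_comp (measurable_tnth i)). Qed.

Definition coord U i : {RV P >-> R} :=
  HB.pack (fun w => tnth (U w) i)
    (isMeasurableFun.Build _ _ _ _ _ (measurable_coord U i)).

Lemma iid_pair_coord X U V i :
  iid_pair P (distribution P X) U V ->
  iid_pair P (distribution P (coord X i)) (coord U i) (coord V i).
Proof.
move=> UV.
exact: (iid_pair_comp (nu := distribution P (coord X i)) UV (measurable_tnth i)).
Qed.

Lemma iid_pair_tail X U V U' V' (C : set (p.-tuple R * p.-tuple R)) :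
  iid_pair P (distribution P X) U V -> iid_pair P (distribution P X) U' V' ->
  measurable C -> P [set w | C (U w, V w)] = P [set w | C (U' w, V' w)].
Proof. by move=> h h' mC; rewrite (iid_pair_law h mC) (iid_pair_law h' mC). Qed.

Lemma measurable_Ldist U V : measurable_fun setT (Ldist P U V).
Proof.
apply: measurable_funM => //; apply: measurable_funB => //.
by apply: measurable_funX; exact: measurable_edist.
Qed.

(** This transfers the rate assumed for (X, X') to every pair of sample points; the centering stays
    that of (X, X'). *)
Lemma Ldist_tail X X' U V (c : R) :
  iid_pair P (distribution P X) X X' -> iid_pair P (distribution P X) U V ->
  P [set w | c < `|(Defs.edist (U w) (V w) ^+ 2 - tau2 P X X') / tau2 P X X'|]
  = P [set w | c < `|Ldist P X X' w|].
Proof.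
move=> h h'.
pose C := [set z : p.-tuple R * p.-tuple R |
  c < `|(Defs.edist z.1 z.2 ^+ 2 - tau2 P X X') / tau2 P X X'|].
have mC : measurable C.
  rewrite -[C]setTI; apply: (measurable_fun_ltr (f := cst c)) => //.
  apply: measurableT_comp => //; apply: measurable_funM => //.
  by apply: measurable_funB => //; apply: measurable_funX; exact: measurable_edist.
exact: (iid_pair_tail h' h mC).
Qed.

Variables (a b : R) (X U V : {RV P >-> (p.-tuple R)}).
Hypothesis UV : iid_pair P (distribution P X) U V.
Hypothesis hX : forall i, (a%:E <= 'V_P[fun w => tnth (X w) i])%E /\
  ('E_P[fun w => (tnth (X w) i ^+ 2)%R] <= b%:E)%E.

(** The squared distance is a sum over coordinates, each with mean in [a, 4b]. The lower end makes
    the division in L_X meaningful, the upper end compares tau with sqrt (pq). *)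
Lemma tau2_itv : a * p%:R <= tau2 P U V <= 4 * b * p%:R.
Proof.
pose D i := (\int[P]_w ((coord U i w - coord V i w) ^+ 2)%:E)%E.
have E : ('E_P[fun w => (Defs.edist (U w) (V w) ^+ 2)%R] = \sum_(i < p) D i)%E.
  rewrite unlock; under eq_integral do rewrite sqr_edist -sumEFin.
  rewrite ge0_integral_sum// => [i|i w _]; last by rewrite lee_fin sqr_ge0.
  apply/measurable_EFinP; apply: measurable_funX.
  by apply: measurable_funB; exact: measurable_coord.
have lo i : (a%:E <= D i)%E.
  have [h1 h2] := hX i; apply: (iid_pair_sqrB_ge (iid_pair_coord i UV)) => //.
  exact: le_lt_trans h2 (ltry _).
have hi i : (D i <= (4 * b)%:E)%E.
  by have [h1 h2] := hX i; apply: (iid_pair_sqrB_le (iid_pair_coord i UV)).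
have Dfin i : D i \is a fin_num.
  by apply: fin_real; rewrite (lt_le_trans (ltNyr a)) ?lo//= (le_lt_trans (hi i)) ?ltry.
rewrite /tau2 E -(eq_bigr _ (fun i _ => fineK (Dfin i))) sumEFin /=.
have S (c : R) : c * p%:R = \sum_(i < p) c.
  by rewrite sumr_const card_ord mulr_natr.
by rewrite !S; apply/andP; split; apply: ler_sum => i _;
  rewrite -lee_fin fineK.
Qed.

End random_vectors.

Section sample.
Context d (T : measurableType d) (R : realType) (P : probability T R) (n p q : nat).
Variables (X : {RV P >-> (p.-tuple R)}) (Y : {RV P >-> (q.-tuple R)}).
Variables (Xs : 'I_n -> {RV P >-> (p.-tuple R)}) (Ys : 'I_n -> {RV P >-> (q.-tuple R)}).
Variables (b b' : R).
Hypothesis n3 : (3 <= n)%N.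
Hypothesis iidX : forall s t, s != t -> iid_pair P (distribution P X) (Xs s) (Xs t).
Hypothesis iidY : forall s t, s != t -> iid_pair P (distribution P Y) (Ys s) (Ys t).
Hypothesis hX : forall i, ('E_P[fun w => (tnth (X w) i ^+ 2)%R] <= b%:E)%E.
Hypothesis hY : forall j, ('E_P[fun w => (tnth (Y w) j ^+ 2)%R] <= b'%:E)%E.

Lemma uCov2_sqr_ae (t2 u2 : R) : t2 != 0 -> u2 != 0 ->
  {ae P, forall w,
    uCov2 P (fun x y => `|x - y| ^+ 2) (fun x y => `|x - y| ^+ 2)
      (fun s => Xs s : T -> _) (fun s => Ys s : T -> _) w
    = (Num.sqrt (p%:R * q%:R))^-1
      * (t2 * u2 * uprod (relsq t2 (fun s => Xs s w)) (relsq u2 (fun s => Ys s w)))}.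
Proof.
move=> t20 u20.
have : {ae P, forall w,
    uCov2 P (fun x y => `|x - y| ^+ 2) (fun x y => `|x - y| ^+ 2)
      (fun s => Xs s : T -> _) (fun s => Ys s : T -> _) w
    = (Num.sqrt (p%:R * q%:R))^-1 * \sum_(i < p) \sum_(j < q)
      uprod (\matrix_(s, t) `|tnth (Xs s w) i - tnth (Xs t w) i| ^+ 2)
            (\matrix_(s, t) `|tnth (Ys s w) j - tnth (Ys t w) j| ^+ 2)}.
  apply: (uCov2_ae (mu := fun i => distribution P (coord X i))
    (nu := fun j => distribution P (coord Y j)) n3).
  - by move=> i s; exact: measurable_coord.
  - by move=> j s; exact: measurable_coord.
  - by move=> i s t st; exact: (iid_pair_coord i (iidX st)).
  - by move=> j s t st; exact: (iid_pair_coord j (iidY st)).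
  - by move=> z; rewrite subrr normr0 expr0n.
  - by move=> z z'; rewrite distrC.
  - apply: measurable_funX; apply: measurableT_comp => //; exact: measurable_funB.
  - move=> i s t st; have := iid_pair_sqrB_integrable (iid_pair_coord i (iidX st)) (hX i).
    by under [in X in X -> _]eq_fun do rewrite -[X in X%:E]real_normK ?num_real//.
  - move=> i s t st; have := iid_pair_sqrB_integrable (iid_pair_coord i (iidY st)) (hY i).
    by under [in X in X -> _]eq_fun do rewrite -[X in X%:E]real_normK ?num_real//.
by apply: filterS => w ->; rewrite (sum_uprod_sqr _ _ n3 t20 u20).
Qed.

Lemma mdCov2_ae : {ae P, forall w,
  mdCov2 (fun s => Xs s w) (fun s => Ys s w)
  = Num.sqrt (p%:R * q%:R) * Num.sqrt ('C(n, 2)%:R)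
    * uCov2 P (fun x y => `|x - y|) (fun x y => `|x - y|)
      (fun s => Xs s : T -> _) (fun s => Ys s : T -> _) w}.
Proof.
have : {ae P, forall w,
    uCov2 P (fun x y => `|x - y|) (fun x y => `|x - y|)
      (fun s => Xs s : T -> _) (fun s => Ys s : T -> _) w
    = (Num.sqrt (p%:R * q%:R))^-1 * \sum_(i < p) \sum_(j < q)
      uprod (\matrix_(s, t) `|tnth (Xs s w) i - tnth (Xs t w) i|)
            (\matrix_(s, t) `|tnth (Ys s w) j - tnth (Ys t w) j|)}.
  apply: (uCov2_ae (mu := fun i => distribution P (coord X i))
    (nu := fun j => distribution P (coord Y j)) n3).
  - by move=> i s; exact: measurable_coord.
  - by move=> j s; exact: measurable_coord.
  - by move=> i s t st; exact: (iid_pair_coord i (iidX st)).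
  - by move=> j s t st; exact: (iid_pair_coord j (iidY st)).
  - by move=> z; rewrite subrr normr0.
  - by move=> z z'; rewrite distrC.
  - apply: measurableT_comp => //; exact: measurable_funB.
  - move=> i s t st; exact: (iid_pair_normB_integrable (iid_pair_coord i (iidX st)) (hX i)).
  - move=> i s t st; exact: (iid_pair_normB_integrable (iid_pair_coord i (iidY st)) (hY i)).
apply: filterS => w ->; rewrite /mdCov2 -mulrA mulrCA; congr (_ * _).
(* When [p] or [q] is 0, the normalisation cannot be cancelled, but both double sums are empty. *)
have [p0|p0] := posnP p.
  by subst p; rewrite !big_ord0 !mulr0.
have [q0|q0] := posnP q.
  by subst q; rewrite !big1 ?mulr0// => i _; rewrite big_ord0.
by rewrite mulVKf// sqrtr_eq0 -ltNge mulr_gt0// ltr0n.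
Qed.

End sample.

(** The null set comes only from the identity for [uCov], which does not involve [e] and [e']; hence
    these may be quantified inside, and the rest is deterministic. *)
Lemma sample_expansion_ae d (T : measurableType d) (R : realType)
    (P : probability T R) (n p q : nat)
    (X : {RV P >-> (p.-tuple R)}) (Y : {RV P >-> (q.-tuple R)})
    (Xs : 'I_n -> {RV P >-> (p.-tuple R)}) (Ys : 'I_n -> {RV P >-> (q.-tuple R)})
    (b b' t2 u2 B K : R) (f g : R -> R) :
  let k := fun x y : R => `|x - y| ^+ 2 in
  let tau := Num.sqrt t2 * Num.sqrt u2 in
  let C := uprod_cst R n in
  let uCov := uCov2 P k k (fun s => Xs s : T -> _) (fun s => Ys s : T -> _) in
  let xs w := fun s => Xs s w in let ys w := fun s => Ys s w in
  let gX w := bandwidth (xs w) in let gY w := bandwidth (ys w) in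
  (4 <= n)%N ->
  (forall s t, s != t -> iid_pair P (distribution P X) (Xs s) (Xs t)) ->
  (forall s t, s != t -> iid_pair P (distribution P Y) (Ys s) (Ys t)) ->
  (forall i, ('E_P[fun w => (tnth (X w) i ^+ 2)%R] <= b%:E)%E) ->
  (forall j, ('E_P[fun w => (tnth (Y w) j ^+ 2)%R] <= b'%:E)%E) ->
  (0 < p)%N -> (0 < q)%N -> 0 < t2 -> 0 < u2 ->
  tau <= B * Num.sqrt (p%:R * q%:R) ->
  0 <= K -> sqrt_taylor_bound f K -> sqrt_taylor_bound g K ->
  {ae P, forall w, forall e e', 0 <= e <= 2^-1 -> 0 <= e' <= 2^-1 ->
    (forall s t, `|relsq t2 (xs w) s t| <= e) ->
    (forall s t, `|relsq u2 (ys w) s t| <= e') ->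
    [/\ `|uCov w| <= B * C * (tau * e * e'),
        `|dCov2 (xs w) (ys w)
          - 4^-1 * (Num.sqrt (p%:R * q%:R) / tau) * uCov w|
        <= C * 2 * (tau * (e ^+ 2 * e' + e * e' ^+ 2)) &
        `|tau * hCov2 f g (xs w) (ys w)
          - Num.sqrt (p%:R * q%:R) / (4 * gX w * gY w)
            * (f^`())%classic (Num.sqrt t2 / gX w)
            * (g^`())%classic (Num.sqrt u2 / gY w) * uCov w|
        <= C * (2 * (4 * K) ^+ 2) * (tau * (e ^+ 2 * e' + e * e' ^+ 2))]}.
Proof.
move=> k tau C uCov xs ys gX gY n4 iX iY hX hY p0 q0 t20 u20 tauB K0 hf hg.
have n2 : (2 <= n)%N by exact: leq_trans n4.
have n3 : (3 <= n)%N by exact: ltnW.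
have := uCov2_sqr_ae n3 iX iY hX hY (lt0r_neq0 t20) (lt0r_neq0 u20).
apply: filterS => w Ew e e' he he' hx hy.
have [gX0 _] := bandwidth_relsq n2 t20 he hx.
have [gY0 _] := bandwidth_relsq n2 u20 he' hy.
rewrite -/(gX w) in gX0; rewrite -/(gY w) in gY0.
have pq0 : Num.sqrt (p%:R * q%:R) != 0 :> R.
  by rewrite sqrtr_eq0 -ltNge mulr_gt0// ltr0n.
have st0 : 0 < Num.sqrt t2 by rewrite sqrtr_gt0.
have su0 : 0 < Num.sqrt u2 by rewrite sqrtr_gt0.
have tau0 : 0 < tau by exact: mulr_gt0.
have tuE : t2 * u2 = tau ^+ 2 by rewrite exprMn !sqr_sqrtr// ltW.
rewrite /uCov Ew tuE -/(xs w) -/(ys w).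
set S := Num.sqrt (p%:R * q%:R) in pq0 tauB *.
have S0 : 0 < S by rewrite lt0r pq0 sqrtr_ge0.
have /andP[e0 e1] := he; have /andP[e0' e1'] := he'.
split.
(* One factor of [tau ^+ 2] is traded for [B * S], which cancels the normalisation [S^-1]. *)
- have C0 := uprod_cst_ge0 R n; rewrite -/C in C0.
  have hU := uprod_le n4 e0 e0' hx hy.
  rewrite normrM (gtr0_norm (_ : 0 < S^-1)) ?invr_gt0//.
  rewrite normrM (gtr0_norm (exprn_gt0 _ _))//.
  rewrite mulrC ler_pdivrMr//.
  apply: (@le_trans _ _ (tau ^+ 2 * (C * (e * e')))).
    by rewrite ler_wpM2l// ltW// exprn_gt0.
  rewrite [leRHS](_ : _ = (B * S) * (tau * (C * (e * e')))); last by ring.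
  rewrite expr2 -mulrA ler_wpM2r// !mulr_ge0// ltW//.
- rewrite [X in `|_ - X|](_ : _ = 4^-1 * tau * uprod (relsq t2 (xs w)) (relsq u2 (ys w))).
    apply: le_trans (dCov2_expansion n4 t20 u20 _ _ hx hy) _.
    + by rewrite e0; lra.
    + by rewrite e0'; lra.
    + by rewrite -/tau -/C mulrCA.
  by field; rewrite pq0 lt0r_neq0.
- have H := hCov2_expansion n4 t20 u20 he he' K0 hx hy hf hg.
  rewrite -/(gX w) -/(gY w) in H.
  set U := uprod _ _ in H *.
  set f' := (f^`())%classic _ in H *; set g' := (g^`())%classic _ in H *.
  rewrite [X in `|_ - X|](_ : _ = tau * (2^-1 * (Num.sqrt t2 / gX w) * f'
     * (2^-1 * (Num.sqrt u2 / gY w) * g') * U)).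
    by rewrite -mulrBr normrM (gtr0_norm tau0) [leRHS]mulrCA ler_wpM2l // ltW.
  by rewrite /tau; field; rewrite pq0 !lt0r_neq0.
Qed.

(** * Asymptotics *)

Lemma probability_exists_le d (T : measurableType d) (R : realType)
    (P : probability T R) (I : finType) (A : I -> set T) (e : R) :
  (forall i, measurable (A i)) -> (forall i, P (A i) <= e%:E)%E ->
  measurable [set w | exists i, A i w] /\
  (P [set w | exists i, A i w] <= (#|I|%:R * e)%:E)%E.
Proof.
move=> mA hA.
have H (s : seq I) : measurable [set w | exists2 i, i \in s & A i w] /\
    (P [set w | exists2 i, i \in s & A i w] <= ((size s)%:R * e)%:E)%E.
  elim: s => [|i s [mS PS]].
    rewrite (_ : mkset _ = set0); first by rewrite measure0 mul0r.
    by rewrite -subset0 => w [].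
  have -> : [set w | exists2 j, j \in i :: s & A j w]
      = A i `|` [set w | exists2 j, j \in s & A j w].
    apply/seteqP; split => w /=.
      by case=> j; rewrite inE => /predU1P[->|js] Aj; [left|right; exists j].
    case=> [Ai|[j js Aj]]; first by exists i; rewrite ?mem_head.
    by exists j; rewrite // inE js orbT.
  split; first exact: measurableU.
  rewrite (_ : (size (i :: s))%:R = 1 + (size s)%:R); last by rewrite addrC natr1.
  rewrite mulrDl mul1r EFinD.
  apply: le_trans (measureU2 _ _ _) _ => //.
  by apply: leeD; [exact: hA | exact: PS].
have [mE PE] := H (enum I); rewrite cardE.
suff -> : [set w | exists i, A i w] = [set w | exists2 i, i \in enum I & A i w] by [].
by apply/seteqP; split => w /= [i]; exists i => //; rewrite mem_enum.
Qed.

(** A union bound over all [n * n] index pairs; the diagonal contributes nothing because [relsq]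
    vanishes there and [c >= 0]. *)
Lemma relsq_tail d (T : measurableType d) (R : realType) (P : probability T R)
    (n p : nat) (X X' : {RV P >-> (p.-tuple R)}) (Xs : 'I_n -> {RV P >-> (p.-tuple R)})
    (c e : R) :
  iid_pair P (distribution P X) X X' ->
  (forall s t, s != t -> iid_pair P (distribution P X) (Xs s) (Xs t)) ->
  0 <= c -> 0 <= e -> (P [set w | (c < `|Ldist P X X' w|)%R] <= e%:E)%E ->
  let far := [set w | exists st : 'I_n * 'I_n,
    c < `|relsq (tau2 P X X') (fun s => Xs s w) st.1 st.2|] in
  measurable far /\ (P far <= ((n * n)%:R * e)%:E)%E.
Proof.
move=> iX iXs c0 e0 hL far; rewrite -[X in (X * X)%N]card_ord -card_prod.
pose A (st : 'I_n * 'I_n) : set T := [set w |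
  c < `|relsq (tau2 P X X') (fun s => Xs s w) st.1 st.2|].
apply: (@probability_exists_le _ _ _ P _ A) => -[s t].
  rewrite -[X in measurable X]setTI; apply: (measurable_fun_ltr (f := cst c)) => //.
  apply: measurableT_comp => //; under eq_fun do rewrite mxE.
  case: (_ == _); first exact: measurable_cst.
  apply: measurable_funM => //; apply: measurable_funB => //.
  by apply: measurable_funX; exact: measurable_edist.
have [st|st] := eqVneq s t.
  suff -> : A (s, t) = set0 by rewrite measure0 lee_fin.
  by rewrite -subset0 => w; rewrite /A /= mxE st eqxx normr0 ltNge c0.
move: hL; rewrite -(Ldist_tail c iX (iXs s t st)); apply: le_trans.
rewrite le_eqVlt; apply/orP; left; apply/eqP; congr (P _).
by apply/funext => w; rewrite /A /= mxE (negbTE st).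
Qed.

Section asymptotics.
Context (R : realType) (d : nat -> nat -> measure_display).
Context (T : forall p q, measurableType (d p q)).
Context (P : forall p q, probability (T p q) R).
Implicit Types (Z : forall p q, T p q -> R) (c : nat -> nat -> R).

Lemma measurable_ltr_norm p q (Z : T p q -> R) (c : R) :
  measurable_fun setT Z -> measurable [set w | c < `|Z w|].
Proof.
move=> mZ; rewrite -[X in measurable X]setTI.
by apply: (measurable_fun_ltr (f := cst c)) => //; exact: measurableT_comp.
Qed.

(** The exceedance event is covered by the complement of the good event and the null set where the
    almost sure bound fails. *)
Lemma bigOp_of_event Z c (good : R -> forall p q, set (T p q)) :
  (forall p q, measurable_fun setT (Z p q)) ->
  (forall e : R, 0 < e -> exists2 M : R, 0 < M & \forall pq \near pq_oo,
     measurable (~` good M pq.1 pq.2) /\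
     (P pq.1 pq.2 (~` good M pq.1 pq.2) <= e%:E)%E) ->
  (forall M : R, 0 < M -> exists2 K : R, 0 < K & \forall pq \near pq_oo,
     {ae P pq.1 pq.2, forall w, good M pq.1 pq.2 w ->
       `|Z pq.1 pq.2 w| <= K * `|c pq.1 pq.2|}) ->
  bigOp P Z c.
Proof.
move=> mZ hg hZ e e0; have [M M0 hM] := hg e e0; have [K K0 hK] := hZ M M0.
exists K => //; apply: filterS2 hM hK => -[p q] /= [mG PG] [N [mN N0 sN]].
apply: le_trans PG; rewrite -[leRHS]adde0 -N0.
apply: le_trans (measureU2 _ mG mN); apply: le_measure.
- by rewrite inE; exact: measurable_ltr_norm.
- by rewrite inE; exact: measurableU.
- move=> w /= hw; have [gw|] := pselect (good M p q w); last by left.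
  by right; apply: sN => /= /(_ gw); rewrite leNgt hw.
Qed.

(** If [M] bounds the tail at the scale of [c] by [x], then eventually [c] is at most [e / M] times
    [c'] in absolute value, and exceeding [e * c'] forces exceeding [M * c]. *)
Lemma bigOp_littleop Z c c' :
  (forall p q, measurable_fun setT (Z p q)) -> bigOp P Z c ->
  (forall e : R, 0 < e -> \forall pq \near pq_oo,
     `|c pq.1 pq.2| <= e * `|c' pq.1 pq.2|) ->
  littleop P Z c'.
Proof.
move=> mZ hZ hc e e0.
pose S pq := [set w | e * `|c' pq.1 pq.2| < `|Z pq.1 pq.2 w|].
have mS pq : measurable (S pq) by exact: measurable_ltr_norm.
have -> : (fun pq => P pq.1 pq.2 (S pq)) = EFin \o (fun pq => fine (P pq.1 pq.2 (S pq))).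
  by apply/funext => pq /=; rewrite fineK// fin_num_measure.
apply: cvg_EFin; first exact: nearW.
apply/cvgr0Pnorm_le => x x0; have [M M0 hM] := hZ x x0.
have eM : 0 < e / M by exact: divr_gt0.
apply: filterS2 hM (hc _ eM) => -[p q] /= hM hcc.
have fS : P p q (S (p, q)) \is a fin_num := fin_num_measure _ _ (mS (p, q)).
rewrite ger0_norm ?fine_ge0 ?measure_ge0// -lee_fin fineK//.
apply: le_trans hM; apply: le_measure; rewrite ?inE//.
- exact: (mS (p, q)).
- exact: measurable_ltr_norm.
- move=> w /=; apply: le_lt_trans.
  by rewrite mulrC -ler_pdivlMr// mulrAC.
Qed.

End asymptotics.

Lemma sqrt_taylor_bound_exists (R : realType) (f g : R -> R) :
  C1 f -> C1 g -> radial_kernel f -> radial_kernel g ->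
  exists K, [/\ 0 <= K, sqrt_taylor_bound f K & sqrt_taylor_bound g K].
Proof.
move=> hf hg hfk hgk.
have c0 : 0 < 3^-1 :> R by rewrite invr_gt0.
have [K1 K10 h1] := radial_kernel_taylor hf hfk c0.
have [K2 K20 h2] := radial_kernel_taylor hg hgk c0.
exists (K1 + K2); split; first exact: addr_ge0.
- move=> s t s3 t3; have [a1 a2] := h1 s t s3 t3; split.
    by apply: le_trans a1 _; rewrite ler_wpM2r ?sqr_ge0// lerDl.
  by rewrite (le_trans a2)// lerDl.
- move=> s t s3 t3; have [a1 a2] := h2 s t s3 t3; split.
    by apply: le_trans a1 _; rewrite ler_wpM2r ?sqr_ge0// lerDr.
  by rewrite (le_trans a2)// lerDr.
Qed.

Lemma near_pq_fst (A : set nat) :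
  (\forall p \near \oo, A p) -> \forall pq \near pq_oo, A pq.1.
Proof. by move=> hA; apply: cvg_fst hA. Qed.

Lemma near_pq_snd (A : set nat) :
  (\forall p \near \oo, A p) -> \forall pq \near pq_oo, A pq.2.
Proof. by move=> hA; apply: cvg_snd hA. Qed.

Lemma near_mul_norm_le (R : realType) (al : nat -> R) (M e : R) :
  al @ \oo --> (0 : R) -> 0 < M -> 0 < e -> \forall p \near \oo, M * `|al p| <= e.
Proof.
move=> /cvgr0Pnorm_le h M0 e0.
by apply: filterS (h _ (divr_gt0 e0 M0)) => p; rewrite ler_pdivlMr// mulrC.
Qed.

Unset Implicit Arguments.

Theorem proposition2p2p4
  (R : realType) (n : nat) (hn : (4 <= n)%N)
  (d : nat -> nat -> measure_display)
  (T : forall p q : nat, measurableType (d p q))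
  (P : forall p q : nat, probability (T p q) R)
  (* (X, Y), its independent copy (X', Y'), and the sample (Xs s, Ys s) *)
  (X X' : forall p q : nat, {RV (P p q) >-> (p.-tuple R)})
  (Y Y' : forall p q : nat, {RV (P p q) >-> (q.-tuple R)})
  (Xs : forall p q : nat, 'I_n -> {RV (P p q) >-> (p.-tuple R)})
  (Ys : forall p q : nat, 'I_n -> {RV (P p q) >-> (q.-tuple R)})
  (hcopy : forall p q : nat,
     same_law (P p q) (fun w => (X' p q w, Y' p q w))
                      (fun w => (X p q w, Y p q w)))
  (hcopy_indep : forall p q : nat,
     mutually_independent (P p q)
       (fun (b : bool) w => if b then (X p q w, Y p q w)
                            else (X' p q w, Y' p q w)))
  (hsample : forall (p q : nat) (s : 'I_n),
     same_law (P p q) (fun w => (Xs p q s w, Ys p q s w))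
                      (fun w => (X p q w, Y p q w)))
  (hsample_indep : forall p q : nat,
     mutually_independent (P p q)
       (fun (s : 'I_n) w => (Xs p q s w, Ys p q s w)))
  (a b a' b' : R) (ha : 0 < a) (ha' : 0 < a')
  (hX : forall (p q : nat) (i : 'I_p),
     (a%:E <= 'V_(P p q)[fun w => tnth (X p q w) i])%E /\
     ('E_(P p q)[fun w => (tnth (X p q w) i ^+ 2)%R] <= b%:E)%E)
  (hY : forall (p q : nat) (j : 'I_q),
     (a'%:E <= 'V_(P p q)[fun w => tnth (Y p q w) j])%E /\
     ('E_(P p q)[fun w => (tnth (Y p q w) j ^+ 2)%R] <= b'%:E)%E)
  (f g : R -> R) (hf : C1 f) (hg : C1 g)
  (hfk : radial_kernel f) (hgk : radial_kernel g) :
  let tauX p q := Num.sqrt (tau2 (P p q) (X p q) (X' p q)) in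
  let tauY p q := Num.sqrt (tau2 (P p q) (Y p q) (Y' p q)) in
  let tau p q := tauX p q * tauY p q in
  let xs p q w := fun s => Xs p q s w in
  let ys p q w := fun s => Ys p q s w in
  let uCov k p q w := uCov2 (P p q) k k (fun s => Xs p q s : T p q -> _)
                                        (fun s => Ys p q s : T p q -> _) w in
  (* (i) *)
  (let k := fun x y : R => `|x - y| ^+ 2 in
   exists R' R'' : forall p q : nat, T p q -> R,
     [/\ forall (p q : nat) (w : T p q),
           dCov2 (xs p q w) (ys p q w)
           = 4^-1 * (Num.sqrt (p%:R * q%:R) / tau p q) * uCov k p q w
             + R' p q w,
         forall (p q : nat) (w : T p q),
           let gX := bandwidth (xs p q w) in
           let gY := bandwidth (ys p q w) in
           tau p q * hCov2 f g (xs p q w) (ys p q w)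
           = Num.sqrt (p%:R * q%:R) / (4 * gX * gY)
             * (f^`())%classic (tauX p q / gX) * (g^`())%classic (tauY p q / gY) * uCov k p q w
             + R'' p q w
       & forall al be : nat -> R,
           bigOp P (fun p q => Ldist (P p q) (X p q) (X' p q))
                 (fun p _ => al p) ->
           bigOp P (fun p q => Ldist (P p q) (Y p q) (Y' p q))
                 (fun _ q => be q) ->
           al @ \oo --> (0 : R) ->
           be @ \oo --> (0 : R) ->
           littleo1 (fun p q => tauX p q ^+ 2 * al p ^+ 3) ->
           littleo1 (fun p q => tauY p q ^+ 2 * be q ^+ 3) ->
           littleo1 (fun p q => tau p q * al p ^+ 2 * be q) ->
           littleo1 (fun p q => tau p q * al p * be q ^+ 2) ->
           (* for nonnegative rates the absolute values are immaterial *)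
           let lead p q := tau p q * `|al p| * `|be q| in
           let rem p q := tau p q * `|al p| ^+ 2 * `|be q|
                          + tau p q * `|al p| * `|be q| ^+ 2 in
           [/\ bigOp P (uCov k) lead,
               bigOp P R' rem /\ littleop P R' (fun _ _ => 1),
               bigOp P R'' rem /\ littleop P R'' (fun _ _ => 1)
             & littleop P R' lead /\ littleop P R'' lead]]) /\
  (* (ii) *)
  (let k := fun x y : R => `|x - y| in
   forall p q : nat, {ae P p q, forall w : T p q,
     mdCov2 (xs p q w) (ys p q w)
     = Num.sqrt (p%:R * q%:R) * Num.sqrt ('C(n, 2)%:R) * uCov k p q w}).
Proof.
move=> tauX tauY tau xs ys uCov.
have n3 : (3 <= n)%N by exact: ltnW.
have mfst r r' : measurable_fun setT (@fst (r.-tuple R) (r'.-tuple R)) by [].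
have msnd r r' : measurable_fun setT (@snd (r.-tuple R) (r'.-tuple R)) by [].
have law_copy p q (c : bool) : same_law (P p q)
    (fun w => if c then (X p q w, Y p q w) else (X' p q w, Y' p q w))
    (fun w => (X p q w, Y p q w)).
  by case: c => [//|]; exact: hcopy.
have iX p q : iid_pair (P p q) (distribution (P p q) (X p q)) (X p q) (X' p q).
  exact: (@mutually_independent_iid_pair _ _ _ _ _ _ R (P p q) _ _
    (fun w => (X p q w, Y p q w)) fst (X p q) true false (hcopy_indep p q) isT
    (law_copy p q) (mfst p q) erefl).
have iY p q : iid_pair (P p q) (distribution (P p q) (Y p q)) (Y p q) (Y' p q).
  exact: (@mutually_independent_iid_pair _ _ _ _ _ _ R (P p q) _ _
    (fun w => (X p q w, Y p q w)) snd (Y p q) true false (hcopy_indep p q) isT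
    (law_copy p q) (msnd p q) erefl).
have iXs p q s t : s != t ->
    iid_pair (P p q) (distribution (P p q) (X p q)) (Xs p q s) (Xs p q t).
  move=> st; exact: (@mutually_independent_iid_pair _ _ _ _ _ _ R (P p q) _ _
    (fun w => (X p q w, Y p q w)) fst (X p q) s t (hsample_indep p q) st
    (hsample p q) (mfst p q) erefl).
have iYs p q s t : s != t ->
    iid_pair (P p q) (distribution (P p q) (Y p q)) (Ys p q s) (Ys p q t).
  move=> st; exact: (@mutually_independent_iid_pair _ _ _ _ _ _ R (P p q) _ _
    (fun w => (X p q w, Y p q w)) snd (Y p q) s t (hsample_indep p q) st
    (hsample p q) (msnd p q) erefl).
have hX2 p q i := (hX p q i).2; have hY2 p q j := (hY p q j).2.
split; last first.
  by move=> k p q; exact: (mdCov2_ae n3 (@iXs p q) (@iYs p q) (hX2 p q) (hY2 p q)).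
move=> k.
pose lead2 p q w := Num.sqrt (p%:R * q%:R)
    / (4 * bandwidth (xs p q w) * bandwidth (ys p q w))
  * (f^`())%classic (tauX p q / bandwidth (xs p q w))
  * (g^`())%classic (tauY p q / bandwidth (ys p q w)) * uCov k p q w.
pose R1 p q w := dCov2 (xs p q w) (ys p q w)
  - 4^-1 * (Num.sqrt (p%:R * q%:R) / tau p q) * uCov k p q w.
pose R2 p q w := tau p q * hCov2 f g (xs p q w) (ys p q w) - lead2 p q w.
exists R1, R2; split.
- by move=> p q w; rewrite /R1 addrC subrK.
- by move=> p q w gX gY; rewrite /R2 [RHS]addrC subrK.
move=> al be hal hbe al0 be0 _ _ h21 h12 lead rem.
have mk : measurable_fun setT (fun z : R * R => k z.1 z.2).
  by apply: measurable_funX; apply: measurableT_comp => //; exact: measurable_funB.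
have mU p q : measurable_fun setT (uCov k p q) by exact: measurable_uCov2.
have mf (h : R -> R) : C1 h -> measurable_fun setT h.
  move=> [dh _]; apply: continuous_measurable_fun => x.
  exact/differentiable_continuous/derivable1_diffP.
have mf' (h : R -> R) : C1 h -> measurable_fun setT (h^`())%classic.
  by move=> [_ ch]; exact: continuous_measurable_fun.
have mbX p q : measurable_fun setT (fun w => bandwidth (xs p q w)).
  exact: measurable_bandwidth.
have mbY p q : measurable_fun setT (fun w => bandwidth (ys p q w)).
  exact: measurable_bandwidth.
have minv p q (F : T p q -> R) : measurable_fun setT F ->
    measurable_fun setT (fun w => (F w)^-1).
  by move=> mF; exact: (measurableT_comp (@measurable_invr R)).
have mR1 p q : measurable_fun setT (R1 p q).
  apply: measurable_funB; last exact: measurable_funM.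
  by apply: measurable_uprod => s t; under eq_fun do rewrite mxE;
    exact: measurable_edist.
have mker p q r (h : R -> R) (zs : 'I_n -> {RV (P p q) >-> (r.-tuple R)}) s t :
    C1 h -> measurable_fun setT (fun w => kernel_mx h (fun s => zs s w) s t).
  move=> hh; under eq_fun do rewrite mxE.
  case: (s == t); first exact: measurable_cst.
  apply: (measurableT_comp (mf h hh)); apply: measurable_funM.
    exact: measurable_edist.
  by apply: minv; exact: measurable_bandwidth.
have mR2 p q : measurable_fun setT (R2 p q).
  apply: measurable_funB.
    by apply: measurable_funM => //; apply: measurable_uprod => s t; exact: mker.
  apply: measurable_funM => //; apply: measurable_funM; last first.
    apply: (measurableT_comp (mf' g hg)); apply: measurable_funM => //.
    exact: minv.
  apply: measurable_funM; last first.
    apply: (measurableT_comp (mf' f hf)); apply: measurable_funM => //.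
    exact: minv.
  apply: measurable_funM => //; apply: minv; apply: measurable_funM => //.
  exact: measurable_funM.
have tau0 p q : 0 <= tau p q by apply: mulr_ge0; exact: sqrtr_ge0.
have lead0 p q : 0 <= lead p q.
  by apply: mulr_ge0 => //; apply: mulr_ge0 => //; exact: tau0.
have rem0 p q : 0 <= rem p q.
  have al2 : 0 <= `|al p| ^+ 2 by exact: exprn_ge0.
  have be2 : 0 <= `|be q| ^+ 2 by exact: exprn_ge0.
  have ta2 := mulr_ge0 (tau0 p q) al2.
  have ta1 := mulr_ge0 (tau0 p q) (normr_ge0 (al p)).
  by apply: addr_ge0; apply: mulr_ge0.
pose good (M : R) p q := [set w : T p q |
  (forall s t, `|relsq (tau2 (P p q) (X p q) (X' p q)) (xs p q w) s t| <= M * `|al p|)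
  /\ (forall s t, `|relsq (tau2 (P p q) (Y p q) (Y' p q)) (ys p q w) s t|
        <= M * `|be q|)].
have n0 : (0 < n)%N by exact: leq_trans hn.
have hgood (e : R) : 0 < e -> exists2 M : R, 0 < M & \forall pq \near pq_oo,
    measurable (~` good M pq.1 pq.2) /\
    (P pq.1 pq.2 (~` good M pq.1 pq.2) <= e%:E)%E.
  move=> e0; pose e' := e / (2 * (n * n)%:R).
  have nn0 : 0 < (n * n)%:R :> R by rewrite ltr0n muln_gt0 n0.
  have e'0 : 0 < e' by rewrite divr_gt0// mulr_gt0.
  have [M1 M10 H1] := hal _ e'0; have [M2 M20 H2] := hbe _ e'0.
  (* A single [M] serves both vectors; enlarging the threshold only shrinks the tails. *)
  exists (M1 + M2); first exact: addr_gt0.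
  apply: filterS2 H1 H2 => -[p q] /= H1 H2.
  pose M := M1 + M2.
  have tail (Z : T p q -> R) (N c : R) : measurable_fun setT Z -> N <= M ->
      (P p q [set w | (N * `|c| < `|Z w|)%R] <= e'%:E)%E ->
      (P p q [set w | (M * `|c| < `|Z w|)%R] <= e'%:E)%E.
    move=> mZ NM; apply: le_trans; apply: le_measure; rewrite ?inE.
    - exact: measurable_ltr_norm.
    - exact: measurable_ltr_norm.
    - by move=> w /=; apply: le_lt_trans; rewrite ler_wpM2r.
  have M0 : 0 < M by exact: addr_gt0.
  have [mA PA] := relsq_tail (iX p q) (@iXs p q) (mulr_ge0 (ltW M0) (normr_ge0 (al p)))
    (ltW e'0) (tail _ _ _ (measurable_Ldist _ _) (ler_wpDr (ltW M20) (lexx _)) H1).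
  have [mB PB] := relsq_tail (iY p q) (@iYs p q) (mulr_ge0 (ltW M0) (normr_ge0 (be q)))
    (ltW e'0) (tail _ _ _ (measurable_Ldist _ _) (ler_wpDl (ltW M10) (lexx _)) H2).
  set A := mkset _ in mA PA; set B := mkset _ in mB PB.
  have -> : ~` good M p q = A `|` B.
    apply/seteqP; split => w /=.
      move=> /not_andP[] /existsNP[s] /existsNP[t] /negP; rewrite -ltNge => h.
        by left; exists (s, t).
      by right; exists (s, t).
    move=> [] [[s t]] /= h [h1 h2].
      by have := h1 s t; rewrite leNgt h.
    by have := h2 s t; rewrite leNgt h.
  split; first exact: measurableU.
  apply: le_trans (measureU2 _ mA mB) _.
  apply: le_trans (leeD PA PB) _.
  by rewrite -EFinD lee_fin /e' le_eqVlt; apply/orP; left; apply/eqP; field;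
    rewrite lt0r_neq0// ltr0n.
have [K [K0 Kf Kg]] := sqrt_taylor_bound_exists hf hg hfk hgk.
pose C := uprod_cst R n; have C0 : 0 <= C := uprod_cst_ge0 R n.
(* From the upper bounds [4 * b * p] and [4 * b' * q] on the squared scales. *)
pose B := Num.sqrt (16 * b * b').
have B0 : 0 <= B by exact: sqrtr_ge0.
(* The rates tend to 0, so eventually [M] times each is at most 1/2 and the expansions apply. The
   [+ 1] keeps the constants strictly positive even if the other term vanishes. *)
have hbound (M : R) : 0 < M -> \forall pq \near pq_oo,
    {ae P pq.1 pq.2, forall w, good M pq.1 pq.2 w ->
    [/\ `|uCov k pq.1 pq.2 w| <= (B * C * M ^+ 2 + 1) * `|lead pq.1 pq.2|,
        `|R1 pq.1 pq.2 w| <= (C * 2 * M ^+ 3 + 1) * `|rem pq.1 pq.2| &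
        `|R2 pq.1 pq.2 w|
          <= (C * (2 * (4 * K) ^+ 2) * M ^+ 3 + 1) * `|rem pq.1 pq.2|]}.
  move=> M0.
  have half0 : 0 < 2^-1 :> R by rewrite invr_gt0.
  have near1 : \forall p \near \oo, (0 < p)%N /\ M * `|al p| <= 2^-1.
    apply: filterS2 (nbhs_infty_gt 0) (near_mul_norm_le al0 M0 half0) => p.
    by split.
  have near2 : \forall q \near \oo, (0 < q)%N /\ M * `|be q| <= 2^-1.
    apply: filterS2 (nbhs_infty_gt 0) (near_mul_norm_le be0 M0 half0) => q.
    by split.
  apply: filterS2 (near_pq_fst near1) (near_pq_snd near2).
  move=> [p q] /= [p0 ap] [q0 bq].
  have /andP[t1 t2] := tau2_itv (iX p q) (hX p q).
  have /andP[u1 u2] := tau2_itv (iY p q) (hY p q).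
  have t0 : 0 < tau2 (P p q) (X p q) (X' p q).
    by apply: lt_le_trans t1; rewrite mulr_gt0// ltr0n.
  have u0 : 0 < tau2 (P p q) (Y p q) (Y' p q).
    by apply: lt_le_trans u1; rewrite mulr_gt0// ltr0n.
  have tauB : tau p q <= B * Num.sqrt (p%:R * q%:R).
    rewrite /tau /tauX /tauY -sqrtrM; last exact: ltW.
    rewrite [leRHS]mulrC /B -sqrtrM; last exact: mulr_ge0.
    apply: ler_wsqrtr; apply: le_trans (ler_pM (ltW t0) (ltW u0) t2 u2) _.
    by rewrite le_eqVlt; apply/orP; left; apply/eqP; ring.
  have := sample_expansion_ae hn (@iXs p q) (@iYs p q) (hX2 p q) (hY2 p q)
    p0 q0 t0 u0 tauB K0 Kf Kg.
  apply: filterS => w H [gx gy].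
  have ea : 0 <= M * `|al p| <= 2^-1 by rewrite ap mulr_ge0// ltW.
  have eb : 0 <= M * `|be q| <= 2^-1 by rewrite bq mulr_ge0// ltW.
  have [] := H _ _ ea eb gx gy.
  rewrite -/(tau p q) -/C => h1 h2 h3.
  have remE : tau p q * ((M * `|al p|) ^+ 2 * (M * `|be q|)
      + (M * `|al p|) * (M * `|be q|) ^+ 2) = M ^+ 3 * rem p q.
    by rewrite /rem; ring.
  have grow (x y : R) : 0 <= y -> x * y <= (x + 1) * y.
    by move=> y0; rewrite ler_wpM2r// lerDl.
  rewrite (ger0_norm (lead0 p q)) (ger0_norm (rem0 p q)); split.
  - apply: le_trans h1 _; apply: le_trans (grow _ _ (lead0 p q)).
    by rewrite le_eqVlt; apply/orP; left; apply/eqP; rewrite /lead; ring.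
  - apply: le_trans h2 _; apply: le_trans (grow _ _ (rem0 p q)).
    by rewrite remE mulrA.
  - apply: le_trans h3 _; apply: le_trans (grow _ _ (rem0 p q)).
    by rewrite remE mulrA.
have OU : bigOp P (uCov k) lead.
  apply: (bigOp_of_event mU hgood) => M M0; exists (B * C * M ^+ 2 + 1).
    by apply: ltr_wpDl => //; exact: mulr_ge0 (mulr_ge0 B0 C0) (exprn_ge0 2 (ltW M0)).
  apply: filterS (hbound M M0) => pq; apply: filterS => w h gw.
  by have [] := h gw.
have OR1 : bigOp P R1 rem.
  apply: (bigOp_of_event mR1 hgood) => M M0; exists (C * 2 * M ^+ 3 + 1).
    apply: ltr_wpDl => //.
    exact: mulr_ge0 (mulr_ge0 C0 (ler0n R 2)) (exprn_ge0 3 (ltW M0)).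
  apply: filterS (hbound M M0) => pq; apply: filterS => w h gw.
  by have [] := h gw.
have OR2 : bigOp P R2 rem.
  apply: (bigOp_of_event mR2 hgood) => M M0.
  exists (C * (2 * (4 * K) ^+ 2) * M ^+ 3 + 1).
    apply: ltr_wpDl => //; apply: mulr_ge0 (exprn_ge0 3 (ltW M0)).
    exact: mulr_ge0 C0 (mulr_ge0 (ler0n R 2) (sqr_ge0 _)).
  apply: filterS (hbound M M0) => pq; apply: filterS => w h gw.
  by have [] := h gw.
have rem1 (e : R) : 0 < e -> \forall pq \near pq_oo,
    `|rem pq.1 pq.2| <= e * `|1 : R|.
  move=> e0; have e20 : 0 < e / 2 by rewrite divr_gt0.
  move/cvgr0Pnorm_le : h21 => /(_ _ e20) h21.
  move/cvgr0Pnorm_le : h12 => /(_ _ e20) h12.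
  apply: filterS2 h21 h12 => -[p q] /= h21 h12.
  rewrite normr1 mulr1 (ger0_norm (rem0 p q)) [leRHS]splitr.
  apply: le_trans (lerD h21 h12).
  rewrite normrM normrM normrX [X in _ <= _ + X]normrM [X in _ <= _ + X * _]normrM.
  by rewrite normrX (ger0_norm (tau0 p q)).
have rem_lead (e : R) : 0 < e -> \forall pq \near pq_oo,
    `|rem pq.1 pq.2| <= e * `|lead pq.1 pq.2|.
  move=> e0; have e20 : 0 < e / 2 by rewrite divr_gt0.
  (* The remainder rate is exactly [|al p| + |be q|] times the leading rate, so the ratio tends to
     0. *)
  apply: filterS2 (near_pq_fst (near_mul_norm_le al0 ltr01 e20))
    (near_pq_snd (near_mul_norm_le be0 ltr01 e20)) => -[p q] /=.
  rewrite !mul1r => ap bq.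
  rewrite (ger0_norm (lead0 p q)) (ger0_norm (rem0 p q)).
  rewrite (_ : rem p q = (`|al p| + `|be q|) * lead p q).
    by rewrite ler_wpM2r//; lra.
  by rewrite /rem /lead; ring.
split => //; split => //.
- exact: bigOp_littleop mR1 OR1 rem1.
- exact: bigOp_littleop mR2 OR2 rem1.
- exact: bigOp_littleop mR1 OR1 rem_lead.
- exact: bigOp_littleop mR2 OR2 rem_lead.
Qed.
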